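(* Let $K$ be a field, let $R=K[y_1,\dots,y_m]$ be a polynomial ring, let $X$ be a matrix with two rows whose entries are linear forms of $R$, and let $J=I_2(X)\subseteq R$ be the ideal generated by the $2$-minors of $X$. Let $n\ge 1$, let $S=R[x_1,\dots,x_n]$ be the polynomial ring over $R$ in new variables $x_1,\dots,x_n$, and let \[ N_n=\begin{pmatrix} x_1 & x_2 & \cdots & x_n & 0\\ 0 & x_1 & \cdots & x_{n-1} & x_n \end{pmatrix} \] be the nilpotent block of length $n+1$. Let $M=(X\,|\,N_n)$ be the concatenation of $X$ and $N_n$, and let $I_2(M)\subseteq S$ be the ideal generated by the $2$-minors of $M$. Then \[ \mathrm{cd}_S\big(I_2(M)\big)=\mathrm{cd}_R(J)+n \qquad\text{and}\qquad \mathrm{ara}\big(I_2(M)\big)\leq \mathrm{ara}(J)+n. \]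
   Context: For an ideal $I$ of a Noetherian commutative ring $R$, the cohomological dimension is $\mathrm{cd}_R(I)=\max\{i\in\mathbb{Z} : H^i_I(R)\neq 0\}$, where $H^i_I(R)$ is the $i$-th local cohomology module of $R$ with support in $I$. The arithmetical rank $\mathrm{ara}(I)$ is the smallest integer $s\ge 0$ for which there exist $a_1,\dots,a_s$ in the ambient ring with $\sqrt{I}=\sqrt{(a_1,\dots,a_s)}$; here $\mathrm{ara}(J)$ is taken in $R$ and $\mathrm{ara}(I_2(M))$ in $S$. *)

(* Defs.v *)
From HB Require Import structures.
From mathcomp Require Import all_boot all_order all_algebra.
From mathcomp Require Import mpoly.

Set Implicit Arguments.
Unset Strict Implicit.
Unset Printing Implicit Defensive.

Import GRing.Theory.
Local Open Scope ring_scope.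

(* Ideals are Prop-valued predicates: membership in an ideal of a polynomial *)
(* ring over an arbitrary field need not be given by a boolean test.         *)

Section Ideals.
Variable R : comNzRingType.
Implicit Types (G I : R -> Prop) (x : R).

Definition ideal_gen G x : Prop :=
  exists (r : nat) (c g : 'I_r -> R),
    (forall i, G (g i)) /\ x = \sum_(i < r) c i * g i.

Definition ideal_pow I (t : nat) : R -> Prop :=
  ideal_gen (fun x => exists a : 'I_t -> R,
    (forall i, I (a i)) /\ x = \prod_(i < t) a i).

Definition radical I x : Prop := exists k : nat, I (x ^+ k).

Definition ideal_of_family (s : nat) (a : 'I_s -> R) : R -> Prop :=
  ideal_gen (fun x => exists i, x = a i).

Definition radically_generated I (s : nat) : Prop :=
  exists a : 'I_s -> R,
    forall x, radical I x <-> radical (ideal_of_family a) x.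

Definition is_ara I (s : nat) : Prop :=
  radically_generated I s /\
  forall t, radically_generated I t -> (s <= t)%N.

Definition det_ideal (t p q : nat) (A : 'M[R]_(p, q)) : R -> Prop :=
  ideal_gen (fun x => exists (f : 'I_t -> 'I_p) (g : 'I_t -> 'I_q),
    [/\ forall i j : 'I_t, (i < j)%N -> (f i < f j)%N,
        forall i j : 'I_t, (i < j)%N -> (g i < g j)%N
      & x = \det (mxsub f g A)]).

End Ideals.

Section LocalCohomology.
Variable R : comNzRingType.
Implicit Types (M : lmodType R) (I : R -> Prop).

Definition injective_module M : Prop :=
  forall (A B : lmodType R) (f : {linear A -> B}) (g : {linear A -> M}),
    injective f -> exists h : {linear B -> M}, forall a, h (f a) = g a.

Record injective_resolution M := InjectiveResolution {
  res_mod : nat -> lmodType R;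
  res_d : forall i, {linear res_mod i -> res_mod i.+1};
  res_aug : {linear M -> res_mod 0};
  res_injective : forall i, injective_module (res_mod i);
  res_aug_inj : injective res_aug;
  res_exact0 : forall e, res_d 0 e = 0 <-> exists x, e = res_aug x;
  res_exactS : forall i e,
    res_d i.+1 e = 0 <-> exists e', e = res_d i e'
}.

(* The section functor Gamma_I. *)
Definition torsion I M (e : M) : Prop :=
  exists t : nat, forall a, ideal_pow I t a -> a *: e = 0.

Definition torsion_cocycle I M (E : injective_resolution M) (i : nat)
    (e : res_mod E i) : Prop :=
  torsion I e /\ res_d E i e = 0.

Definition torsion_coboundary I M (E : injective_resolution M) (i : nat) :
    res_mod E i -> Prop :=
  match i return res_mod E i -> Prop with
  | 0 => fun e => e = 0
  | j.+1 => fun e => exists e', torsion I e' /\ e = res_d E j e'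
  end.

(* H^i_I(M) <> 0, where H^i_I is the i-th right derived functor of Gamma_I:  *)
(* the i-th cohomology of Gamma_I(E) is nonzero for an injective resolution  *)
(* E of M.  By the comparison theorem the choice of E is immaterial, so the  *)
(* negation says that this cohomology vanishes for every E.                  *)
Definition local_cohomology_neq0 I M (i : nat) : Prop :=
  exists (E : injective_resolution M) (e : res_mod E i),
    torsion_cocycle I e /\ ~ torsion_coboundary I e.

(* H^i_I vanishes for i < 0, so the maximum may be taken over nat. *)
Definition is_cd I (c : nat) : Prop :=
  local_cohomology_neq0 I R^o c /\
  forall i, local_cohomology_neq0 I R^o i -> (i <= c)%N.

End LocalCohomology.

Lemma is_ara_unique (R : comNzRingType) (I : R -> Prop) (s t : nat) :
  is_ara I s -> is_ara I t -> s = t.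
Proof.
by move=> [Is mins] [It mint]; apply/eqP; rewrite eqn_leq mins // mint.
Qed.

Lemma is_cd_unique (R : comNzRingType) (I : R -> Prop) (c d : nat) :
  is_cd I c -> is_cd I d -> c = d.
Proof.
by move=> [Ic maxc] [Id maxd]; apply/eqP; rewrite eqn_leq maxd // maxc.
Qed.

(* [unlift ord_max j] is [Some j] for j < n and [None] for j = n, while      *)
(* [unlift ord0 j] is [Some j.-1] for j > 0 and [None] for j = 0.            *)
Definition nilpotent_block (R : comNzRingType) (n : nat) :
    'M[{mpoly R[n]}]_(2, n.+1) :=
  \matrix_(i < 2, j < n.+1)
    if unlift (if i == 0 then ord_max else ord0) j is Some l
    then 'X_l else 0.

(* Main.v *)
Require Import Defs.
From HB Require Import structures.
From mathcomp Require Import all_boot all_order all_algebra.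
From mathcomp Require Import boolp classical_sets.
From mathcomp Require Import mpoly.

(* The minors of the nilpotent block give x_1, ..., x_n in the radical, and   *)
(* every other minor of M involving a column of N_n lies in (x_1, ..., x_n);  *)
(* hence the radical of I_2(M) is that of JS + (x_1, ..., x_n), which gives   *)
(* the bound on ara.  For cd one adjoins the variables one at a time.  For    *)
(* S = A[x], the exact sequence 0 -> S -> A((1/x)) -> (1/x)A[[1/x]] -> 0 has  *)
(* a middle term on which x is bijective, hence without cohomology supported  *)
(* in (J, x), and a last term isomorphic to Hom_A(S, A).  If E is an          *)
(* injective resolution of A over A, then Hom_A(S, E) is one of Hom_A(S, A)   *)
(* over S, whose (J, x)-torsion consists of the finite sequences in the       *)
(* J-torsion of E.  So H^(i+1)_(J, x)(S) is a direct sum of copies of         *)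
(* H^i_J(A).  Finally cd J exists: modules over K[y_1, ..., y_m] have         *)
(* injective resolutions of length m, because 0 -> M -> Hom_A(S, M) ->        *)
(* Hom_A(S, M) -> 0 is exact; and if all H^i_J(K[y]) vanished, then killing   *)
(* the variables successively would give H^0_J(K) = 0, while J kills K.       *)

Set Implicit Arguments.
Unset Strict Implicit.
Unset Printing Implicit Defensive.

Import GRing.Theory.
Local Open Scope ring_scope.

(** * Submodules, restriction of scalars, coinduction *)

(** Local cohomology depends only on the torsion functor, and for finitely generated ideals torsion
    can be tested on powers of elements that generate the ideal up to radical ([torsion_tors]). By
    [var_radical], I_2(M) may therefore be replaced by the set [mpoly_gens], namely J together with
    the variables x_1, ..., x_n. Concatenating generators of J up to radical with the variables
    bounds ara ([nilpotent_radically_generated]).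

    For cd, [poly_cohomology_neq0S] shows that one new variable, added both to the ring and to the
    support, shifts the nonvanishing degrees by exactly one, and [poly_cohomology_eq0] that degree 0
    then vanishes. Two ingredients give this: a middle term on which x acts bijectively has no
    cohomology ([bijective_cohomology_eq0]), so the connecting map transports nonvanishing
    ([connecting_neq0]); and coinduction carries resolutions to resolutions and acts termwise on
    torsion ([coind_cohomology_neq0]). Iteration gives [mpoly_cohomology_neq0].

    It remains to see that the maximum defining cd(J) exists. It is bounded by the length of
    resolutions over K[y_1, ..., y_m] ([mpoly_resolutions]), and the set of degrees is nonempty by
    [specialization_nonacyclic], since J has no constant terms. *)

Definition mk_linear (R : comNzRingType) (U V : lmodType R) (f : U -> V)
    (lin_f : linear f) : {linear U -> V} :=
  HB.pack f (GRing.isLinear.Build R U V *:%R f lin_f).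

Section Submodule.
Variables (R : comNzRingType) (M : lmodType R).

Record submod := Submod {
  submod_mem : pred M;
  submod_closedP : submod_closed submod_mem
}.

Variable P : submod.

HB.instance Definition _ :=
  GRing.isSubmodClosed.Build R M (submod_mem P) (submod_closedP P).

Record submod_type := SubmodType {
  submod_val : M;
  submod_valP : submod_val \in submod_mem P
}.

HB.instance Definition _ := [isSub for submod_val].
HB.instance Definition _ := [Choice of submod_type by <:].
HB.instance Definition _ := [SubChoice_isSubZmodule of submod_type by <:].
HB.instance Definition _ := [SubZmodule_isSubLmodule of submod_type by <:].

End Submodule.

Section SubmodOf.
Variables (R : comNzRingType) (M : lmodType R) (P : M -> Prop).
Hypotheses (P0 : P 0) (P_lin : forall a u v, P u -> P v -> P (a *: u + v)).

Lemma submod_of_closed : submod_closed [pred x | `[< P x >]].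
Proof.
split; first exact/asboolP.
by move=> a u v /asboolP Pu /asboolP Pv; apply/asboolP/P_lin.
Qed.

Definition submod_of : submod M := Submod submod_of_closed.

Lemma submod_ofP (u : submod_type submod_of) : P (val u).
Proof. exact/asboolP/(submod_valP u). Qed.

Definition submod_in (x : M) (Px : P x) : submod_type submod_of :=
  @SubmodType R M submod_of x (asboolT Px).

Lemma submod_inK (x : M) (Px : P x) : val (submod_in Px) = x.
Proof. by []. Qed.
End SubmodOf.

(** An alias of the carrier, on which the scaling through [phi] can be declared without clashing
    with that of [S]. *)
Definition restr (A S : comNzRingType) (phi : {rmorphism A -> S})
  (M : lmodType S) : Type := M.

Section Restriction.

Variables (A S : comNzRingType) (phi : {rmorphism A -> S}) (M : lmodType S).
Local Notation restrM := (restr phi M).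
HB.instance Definition _ := GRing.Zmodule.copy restrM M.

Definition restr_scale (a : A) (m : restrM) : restrM := (phi a *: (m : M)).

Lemma restr_scaleA a b m :
  restr_scale a (restr_scale b m) = restr_scale (a * b) m.
Proof. by rewrite /restr_scale scalerA rmorphM. Qed.
Lemma restr_scale1 : left_id 1 restr_scale.
Proof. by move=> m; rewrite /restr_scale rmorph1 scale1r. Qed.
Lemma restr_scaleDr : right_distributive restr_scale +%R.
Proof. by move=> a u v; rewrite /restr_scale scalerDr. Qed.
Lemma restr_scaleDl m : {morph restr_scale^~ m : a b / a + b}.
Proof. by move=> a b; rewrite /restr_scale rmorphD scalerDl. Qed.

HB.instance Definition _ := GRing.Zmodule_isLmodule.Build A restrM
  restr_scaleA restr_scale1 restr_scaleDr restr_scaleDl.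

Lemma restrE (a : A) (m : restrM) : a *: m = phi a *: (m : M) :> M.
Proof. by []. Qed.
End Restriction.

Section RestrMap.
Variables (A S : comNzRingType) (phi : {rmorphism A -> S}) (M N : lmodType S).
Variable f : {linear M -> N}.
Lemma restr_map_linear : linear (f : restr phi M -> restr phi N).
Proof. by move=> a u v; rewrite !restrE linearP. Qed.
Definition restr_map : {linear restr phi M -> restr phi N} :=
  mk_linear restr_map_linear.
End RestrMap.

Section Coinduction.
Variables (A S : comNzRingType) (phi : {rmorphism A -> S}) (M : lmodType A).

(** The module Hom_A(S, M), with S an A-algebra through [phi]; an element of S acts by multiplying
    the argument. *)
Record coind := Coind {
  coind_fun :> S -> M;
  coindP : forall a s t, coind_fun (phi a * s + t) = a *: coind_fun s + coind_fun t
}.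

HB.instance Definition _ := gen_eqMixin coind.
HB.instance Definition _ := gen_choiceMixin coind.

Implicit Types (f g : coind) (s t : S).

Lemma coind_eq f g : (forall s, f s = g s) -> f = g.
Proof.
case: f g => [f Hf] [g Hg] /= /funext E; move: Hf Hg; rewrite E => Hf Hg.
by rewrite (Prop_irrelevance Hf Hg).
Qed.

Lemma coindD f s t : f (s + t) = f s + f t.
Proof. by have := coindP f 1 s t; rewrite rmorph1 mul1r scale1r. Qed.
Lemma coind0 f : f 0 = 0.
Proof. by apply: (@addrI _ (f 0)); rewrite -coindD !addr0. Qed.
Lemma coindZ f a s : f (phi a * s) = a *: f s.
Proof. by rewrite -[phi a * s]addr0 coindP coind0 addr0. Qed.
Lemma coind_sum f I (r : seq I) (F : I -> S) :
  f (\sum_(i <- r) F i) = \sum_(i <- r) f (F i).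
Proof. exact: (big_morph f (coindD f) (coind0 f)). Qed.

Lemma coind_add_subproof f g a s t :
  (f (phi a * s + t) + g (phi a * s + t)) = a *: (f s + g s) + (f t + g t).
Proof. by rewrite !coindP scalerDr addrACA. Qed.
Definition coind_add f g := Coind (coind_add_subproof f g).

Lemma coind_zero_subproof a (s t : S) : 0 = a *: 0 + 0 :> M.
Proof. by rewrite scaler0 addr0. Qed.
Definition coind_zero := Coind coind_zero_subproof.

Lemma coind_opp_subproof f a s t : - f (phi a * s + t) = a *: (- f s) + - f t.
Proof. by rewrite coindP opprD scalerN. Qed.
Definition coind_opp f := Coind (coind_opp_subproof f).

Lemma coind_scale_subproof c f a s t :
  f (c * (phi a * s + t)) = a *: f (c * s) + f (c * t).
Proof. by rewrite mulrDr mulrCA coindP. Qed.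
Definition coind_scale c f := Coind (coind_scale_subproof c f).

Lemma coind_addA : associative coind_add.
Proof. by move=> f g h; apply: coind_eq => s /=; rewrite addrA. Qed.
Lemma coind_addC : commutative coind_add.
Proof. by move=> f g; apply: coind_eq => s /=; rewrite addrC. Qed.
Lemma coind_add0 : left_id coind_zero coind_add.
Proof. by move=> f; apply: coind_eq => s /=; rewrite add0r. Qed.
Lemma coind_addN : left_inverse coind_zero coind_opp coind_add.
Proof. by move=> f; apply: coind_eq => s /=; rewrite addNr. Qed.
HB.instance Definition _ := GRing.isZmodule.Build coind
  coind_addA coind_addC coind_add0 coind_addN.

Lemma coind_scaleA a b f : coind_scale a (coind_scale b f) = coind_scale (a * b) f.
Proof. by apply: coind_eq => s /=; rewrite mulrCA mulrA. Qed.
Lemma coind_scale1 : left_id 1 coind_scale.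
Proof. by move=> f; apply: coind_eq => s /=; rewrite mul1r. Qed.
Lemma coind_scaleDr : right_distributive coind_scale +%R.
Proof. by move=> a f g; apply: coind_eq. Qed.
Lemma coind_scaleDl f : {morph coind_scale^~ f : a b / a + b}.
Proof. by move=> a b; apply: coind_eq => s /=; rewrite mulrDl coindD. Qed.
HB.instance Definition _ := GRing.Zmodule_isLmodule.Build S coind
  coind_scaleA coind_scale1 coind_scaleDr coind_scaleDl.

Lemma coind_addE f g s : (f + g) s = f s + g s. Proof. by []. Qed.
Lemma coind_0E s : (0 : coind) s = 0. Proof. by []. Qed.
Lemma coind_scaleE c f s : (c *: f) s = f (c * s). Proof. by []. Qed.

End Coinduction.

Section CoindMap.
Variables (A S : comNzRingType) (phi : {rmorphism A -> S}) (M N : lmodType A).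
Variable h : {linear M -> N}.

Lemma coind_map_subproof (f : coind phi M) a s t :
  h (f (phi a * s + t)) = a *: h (f s) + h (f t).
Proof. by rewrite coindP linearP. Qed.
Lemma coind_map_linear :
  linear (fun f : coind phi M => Coind (coind_map_subproof f) : coind phi N).
Proof.
move=> a f g; apply: coind_eq => s.
by rewrite coind_addE coind_scaleE /= linearD.
Qed.
Definition coind_map : {linear coind phi M -> coind phi N} :=
  mk_linear coind_map_linear.
Lemma coind_mapE f s : coind_map f s = h (f s). Proof. by []. Qed.
End CoindMap.

(** Evaluation at 1 identifies S-linear maps into Hom_A(S, E) with A-linear maps into E. The
    extension is made on the A-side, and transposed back as c |-> (s |-> h (s c)). *)
Lemma coind_injective (A S : comNzRingType) (phi : {rmorphism A -> S})
  (E : lmodType A) : injective_module E -> injective_module (coind phi E).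
Proof.
move=> injE B C f g inj_f.
pose g1 (b : restr phi B) := g b 1.
have g1l : linear g1.
  move=> a u v; rewrite /g1 restrE linearP coind_addE coind_scaleE.
  by rewrite coindZ.
have [h Hh] := injE (restr phi B) (restr phi C) (restr_map phi f) (mk_linear g1l) inj_f.
have k_sub (c : C) a s t : h ((phi a * s + t) *: c) = a *: h (s *: c) + h (t *: c).
  by rewrite -linearP; congr (h _); rewrite scalerDl restrE scalerA.
have kl : linear (fun c : C => Coind (k_sub c) : coind phi E).
  move=> a u v; apply: coind_eq => s.
  rewrite coind_addE coind_scaleE /= scalerDr scalerA mulrC.
  by have := linearD h (a * s *: u : restr phi C) (s *: v : restr phi C).
exists (mk_linear kl) => b; apply: coind_eq => s /=.
have -> : s *: f b = f (s *: b) by rewrite linearZ.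
have /= -> := Hh (s *: b : restr phi B); rewrite /g1.
have -> : g (s *: b) = s *: g b by rewrite linearZ.
by rewrite coind_scaleE mulr1.
Qed.

(** * Comparison of injective resolutions *)

Section Comparison.
Variable R : comNzRingType.

(** The map [g] descends to the image of [d], a submodule of V, and injectivity of Q extends it from
    there. Chain maps and homotopies are both built from this one step. *)
Lemma injective_factor (U V Q : lmodType R) (d : {linear U -> V})
    (g : {linear U -> Q}) :
  injective_module Q -> (forall u, d u = 0 -> g u = 0) ->
  exists h : {linear V -> Q}, forall u, h (d u) = g u.
Proof.
move=> injQ ker_dg.
have im0 : exists u, 0 = d u by exists 0; rewrite linear0.
have im_lin a v w : (exists u, v = d u) -> (exists u, w = d u) ->
    exists u, a *: v + w = d u.
  by move=> [u ->] [u' ->]; exists (a *: u + u'); rewrite linearP.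
pose W := submod_type (submod_of im0 im_lin).
have val_lin : linear (val : W -> V) by move=> a u v; exact: linearP.
have val_inj : injective (mk_linear val_lin) by exact: val_inj.
pose pre (w : W) := sval (cid (submod_ofP w)).
have preE (w : W) : val w = d (pre w) by rewrite /pre; case: cid.
have gE u u' : d u = d u' -> g u = g u'.
  move=> duu'; apply/eqP; rewrite -subr_eq0 -linearB; apply/eqP/ker_dg.
  by rewrite linearB duu' subrr.
have g_lin : linear (g \o pre).
  move=> a u v; rewrite /= -linearP; apply: gE.
  by rewrite -preE linearP [val _]val_lin -!preE.
have [h hE] := injQ W V (mk_linear val_lin) (mk_linear g_lin) val_inj.
exists h => u.
have Pdu : exists u', d u = d u' by exists u.
have /= -> := hE (submod_in im0 im_lin Pdu).
by apply: gE; rewrite -preE.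
Qed.

Lemma res_dd (M : lmodType R) (E : injective_resolution M) i (e : res_mod E i) :
  res_d E i.+1 (res_d E i e) = 0.
Proof. by apply/res_exactS; exists e. Qed.

Lemma res_d_aug (M : lmodType R) (E : injective_resolution M) (x : M) :
  res_d E 0 (res_aug E x) = 0.
Proof. by apply/res_exact0; exists x. Qed.

Definition chain_map (M N : lmodType R) (E : injective_resolution M)
    (E' : injective_resolution N) (F : forall i, {linear res_mod E i -> res_mod E' i}) :=
  forall i e, F i.+1 (res_d E i e) = res_d E' i (F i e).

Section Lift.
Variables (M N : lmodType R) (f : {linear M -> N}).
Variables (E : injective_resolution M) (E' : injective_resolution N).

Let cocycle_map i (F : {linear res_mod E i -> res_mod E' i}) :=
  forall e, res_d E i e = 0 -> res_d E' i (F e) = 0.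

Lemma lift_start : exists F : {linear res_mod E 0 -> res_mod E' 0},
  cocycle_map F /\ forall x, F (res_aug E x) = res_aug E' (f x).
Proof.
have comp_lin : linear (res_aug E' \o f) by move=> a u v; rewrite /= !linearP.
have [|F FE] := @injective_factor _ _ _ (res_aug E) (mk_linear comp_lin)
  (@res_injective _ _ E' 0).
  move=> u /eqP; rewrite -(linear0 (res_aug E)) => /eqP/res_aug_inj ->.
  by rewrite linear0.
exists F; split=> // e /res_exact0 [x ->].
by rewrite FE /= res_d_aug.
Qed.

Lemma lift_step i (F : {linear res_mod E i -> res_mod E' i}) : cocycle_map F ->
  exists F' : {linear res_mod E i.+1 -> res_mod E' i.+1},
    cocycle_map F' /\ forall e, F' (res_d E i e) = res_d E' i (F e).
Proof.
move=> Fc.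
have comp_lin : linear (res_d E' i \o F) by move=> a u v; rewrite /= !linearP.
have [//|F' FE] := @injective_factor _ _ _ (res_d E i) (mk_linear comp_lin)
  (@res_injective _ _ E' i.+1).
exists F'; split=> // e /res_exactS [x ->].
by rewrite FE /= res_dd.
Qed.

(** Each stage is bundled with the preservation of cocycles, which is what makes the next stage
    factor through the differential. *)
Fixpoint lift_seq i : {F : {linear res_mod E i -> res_mod E' i} | cocycle_map F} :=
  match i with
  | 0 => let: exist F HF := cid lift_start in exist _ F HF.1
  | j.+1 => let: exist F HF := lift_seq j in
            let: exist F' HF' := cid (lift_step HF) in exist _ F' HF'.1
  end.

Lemma lift_exists : exists F : forall i, {linear res_mod E i -> res_mod E' i},
  chain_map F /\ forall x, F 0%N (res_aug E x) = res_aug E' (f x).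
Proof.
exists (fun i => sval (lift_seq i)); split.
  move=> i e /=; case: (lift_seq i) => F HF /=.
  by case: (cid (lift_step HF)) => F' [].
by move=> x /=; case: (cid lift_start) => F [].
Qed.

End Lift.

Section Homotopy.
Variables (M N : lmodType R).
Variables (E : injective_resolution M) (E' : injective_resolution N).
Variable F : forall i, {linear res_mod E i -> res_mod E' i}.
Hypothesis F_chain : chain_map F.
Hypothesis F_aug : forall x, F 0 (res_aug E x) = 0.

(** Says that F - d h kills the image of d, hence factors through the next differential; the factor
    is the next component of the homotopy. *)
Let prehomotopy i (h : {linear res_mod E i.+1 -> res_mod E' i}) :=
  forall e, F i.+1 (res_d E i e) = res_d E' i (h (res_d E i e)).

Lemma homotopy_start : exists h : {linear res_mod E 1 -> res_mod E' 0},
  prehomotopy h /\ forall e, F 0 e = h (res_d E 0 e).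
Proof.
have [|h hE] := @injective_factor _ _ _ (res_d E 0) (F 0) (@res_injective _ _ E' 0).
  by move=> u /res_exact0 [x ->].
by exists h; split=> // e; rewrite F_chain hE.
Qed.

Lemma homotopy_step i (h : {linear res_mod E i.+1 -> res_mod E' i}) :
  prehomotopy h -> exists h' : {linear res_mod E i.+2 -> res_mod E' i.+1},
  prehomotopy h' /\
  forall e, F i.+1 e = res_d E' i (h e) + h' (res_d E i.+1 e).
Proof.
move=> hc.
have g_lin : linear (fun e => F i.+1 e - res_d E' i (h e)).
  by move=> a u v; rewrite !linearP /= addrACA -scalerDr.
have [|h' hE] := @injective_factor _ _ _ (res_d E i.+1) (mk_linear g_lin)
  (@res_injective _ _ E' i.+1).
  by move=> u /res_exactS [x ->]; rewrite /= hc subrr.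
exists h'; split=> e; last by rewrite hE /= addrC subrK.
by rewrite F_chain hE /= linearB res_dd subr0.
Qed.

Fixpoint homotopy_seq i :
    {h : {linear res_mod E i.+1 -> res_mod E' i} | prehomotopy h} :=
  match i with
  | 0 => let: exist F HF := cid homotopy_start in exist _ F HF.1
  | j.+1 => let: exist F HF := homotopy_seq j in
            let: exist F' HF' := cid (homotopy_step HF) in exist _ F' HF'.1
  end.

Lemma homotopy_exists : exists h : forall i, {linear res_mod E i.+1 -> res_mod E' i},
  (forall e, F 0 e = h 0%N (res_d E 0 e)) /\
  forall i e, F i.+1 e = res_d E' i (h i e) + h i.+1 (res_d E i.+1 e).
Proof.
exists (fun i => sval (homotopy_seq i)); split.
  by move=> e /=; case: (cid homotopy_start) => F' [].
move=> i e /=; case: (homotopy_seq i) => h' Hh /=.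
by case: (cid (homotopy_step Hh)) => h'' [].
Qed.

End Homotopy.
End Comparison.

(** * Cohomology with support *)

Section PowerTorsion.
Variables (R : comNzRingType) (G : R -> Prop).

(** Torsion tested one generator at a time: adjoining a variable to the support just adds one
    condition, and no powers of ideals have to be computed. *)
Definition tors (M : lmodType R) (e : M) : Prop :=
  forall a, G a -> exists t : nat, a ^+ t *: e = 0.

Lemma tors0 (M : lmodType R) : tors (0 : M).
Proof. by move=> a _; exists 0%N; rewrite scaler0. Qed.

Lemma torsP (M : lmodType R) (a : R) (u v : M) :
  tors u -> tors v -> tors (a *: u + v).
Proof.
move=> tu tv b Gb; have [s su] := tu b Gb; have [t tv0] := tv b Gb.
exists (s + t)%N; rewrite scalerDr.
rewrite scalerA mulrC -scalerA addnC exprD -[_ *: u]scalerA su !scaler0 add0r.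
by rewrite mulrC -scalerA tv0 scaler0.
Qed.

Lemma torsD (M : lmodType R) (u v : M) : tors u -> tors v -> tors (u + v).
Proof. by move=> tu tv; rewrite -[u]scale1r; apply: torsP. Qed.

Lemma torsN (M : lmodType R) (u : M) : tors u -> tors (- u).
Proof. by move=> tu; rewrite -scaleN1r -[_ *: _]addr0; apply: torsP (@tors0 _). Qed.

Lemma torsB (M : lmodType R) (u v : M) : tors u -> tors v -> tors (u - v).
Proof. by move=> tu tv; apply: torsD (torsN tv). Qed.

Lemma tors_map (M N : lmodType R) (f : {linear M -> N}) (u : M) :
  tors u -> tors (f u).
Proof.
move=> tu a Ga; have [t tu0] := tu a Ga.
by exists t; rewrite -linearZ tu0 linear0.
Qed.

Section Cochains.
Variables (M : lmodType R) (E : injective_resolution M).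

Definition cocycle i (e : res_mod E i) : Prop := tors e /\ res_d E i e = 0.

Definition coboundary i : res_mod E i -> Prop :=
  match i return res_mod E i -> Prop with
  | 0 => fun e => e = 0
  | j.+1 => fun e => exists e', tors e' /\ e = res_d E j e'
  end.

Lemma coboundary0 i : coboundary (0 : res_mod E i).
Proof.
case: i => [//|i]; exists 0; split; first exact: tors0.
by rewrite linear0.
Qed.

Lemma coboundaryB i (u v : res_mod E i) :
  coboundary u -> coboundary v -> coboundary (u - v).
Proof.
case: i u v => [|i] u v /=; first by move=> -> ->; rewrite subrr.
move=> [u' [tu ->]] [v' [tv ->]]; exists (u' - v').
by split; [exact: torsB | rewrite linearB].
Qed.

End Cochains.

Lemma coboundary_map (M N : lmodType R) (E : injective_resolution M)
    (E' : injective_resolution N) (F : forall i, {linear res_mod E i -> res_mod E' i}) :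
  chain_map F -> forall i (e : res_mod E i), coboundary e -> coboundary (F i e).
Proof.
move=> Fc [|i] e /=; first by move=> ->; rewrite linear0.
by move=> [e' [te' ->]]; exists (F i e'); split; [exact: tors_map | rewrite Fc].
Qed.

Lemma cocycle_map (M N : lmodType R) (E : injective_resolution M)
    (E' : injective_resolution N) (F : forall i, {linear res_mod E i -> res_mod E' i}) :
  chain_map F -> forall i (e : res_mod E i), cocycle e -> cocycle (F i e).
Proof.
move=> Fc i e [te de]; split; first exact: tors_map.
by rewrite -Fc de linear0.
Qed.

Lemma null_homotopic_coboundary (M N : lmodType R) (E : injective_resolution M)
    (E' : injective_resolution N) (F : forall i, {linear res_mod E i -> res_mod E' i}) :
  chain_map F -> (forall x, F 0 (res_aug E x) = 0) ->
  forall i (e : res_mod E i), cocycle e -> coboundary (F i e).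
Proof.
move=> Fc F0; have [h [h0 hS]] := homotopy_exists Fc F0.
case=> [|i] e [te de] /=; first by rewrite h0 de linear0.
by exists (h i e); split; [exact: tors_map | rewrite hS de linear0 addr0].
Qed.

Definition cohomology_neq0 (M : lmodType R) (i : nat) : Prop :=
  exists (E : injective_resolution M) (e : res_mod E i),
    cocycle e /\ ~ coboundary e.

Section TwoLifts.
Variables (M N P : lmodType R).
Variables (E : injective_resolution M) (E' : injective_resolution N)
  (E'' : injective_resolution P).
Variables (F : forall i, {linear res_mod E i -> res_mod E' i})
  (F' : forall i, {linear res_mod E' i -> res_mod E'' i})
  (F1 : forall i, {linear res_mod E i -> res_mod E'' i}).
Hypotheses (Fc : chain_map F) (Fc' : chain_map F') (Fc1 : chain_map F1).
Hypothesis F_aug : forall x, F' 0 (F 0 (res_aug E x)) = F1 0 (res_aug E x).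

Lemma comp_lift_coboundary i (e : res_mod E i) :
  cocycle e -> coboundary (F' i (F i e) - F1 i e).
Proof.
move=> ce.
have lin_H j : linear (fun e => F' j (F j e) - F1 j e).
  by move=> a u v; rewrite !linearP /= addrACA -scalerDr.
apply: (null_homotopic_coboundary (F := fun j => mk_linear (lin_H j)) _ _ ce).
  by move=> j x; rewrite /= Fc Fc' Fc1 linearB.
by move=> x; rewrite /= F_aug subrr.
Qed.
End TwoLifts.

Lemma id_chain_map (M : lmodType R) (E : injective_resolution M) :
  chain_map (E := E) (E' := E) (fun i => idfun).
Proof. by []. Qed.

(** Independence of the resolution: lifts of the identity in both directions compose to a map
    homotopic to the identity, so a nonzero class cannot die on the way. *)
Lemma cohomology_neq0_any (M : lmodType R) (i : nat)
    (E : injective_resolution M) : cohomology_neq0 M i ->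
  exists e : res_mod E i, cocycle e /\ ~ coboundary e.
Proof.
move=> [E' [e [ce ne]]].
have [F [Fc F0]] := lift_exists idfun E' E.
have [F' [Fc' F0']] := lift_exists idfun E E'.
exists (F i e); split; first exact: cocycle_map.
move=> be; apply: ne.
have -> : e = F' i (F i e) - (F' i (F i e) - e) by rewrite opprB addrC subrK.
apply: coboundaryB; first exact: coboundary_map.
have /= := comp_lift_coboundary Fc Fc' (@id_chain_map _ E') _ ce; apply.
by move=> x; rewrite /= F0 F0'.
Qed.

Lemma cohomology0_torsion (M : lmodType R) (E : injective_resolution M) (x : M) :
  tors x -> x <> 0 -> cohomology_neq0 M 0.
Proof.
move=> tx nx; exists E, (res_aug E x); split.
  by split; [exact: tors_map | exact: res_d_aug].
by move=> /= ax0; apply: nx; apply: (@res_aug_inj _ _ E); rewrite ax0 linear0.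
Qed.

(** Multiplication by x is invertible on cohomology because it is so on B, yet every class is killed
    by a power of x; so every class is zero. *)
Lemma bijective_cohomology_eq0 (B : lmodType R) (x : R) (i : nat) : G x ->
  (forall b : B, x *: b = 0 -> b = 0) -> (forall b : B, exists c, b = x *: c) ->
  ~ cohomology_neq0 B i.
Proof.
move=> Gx x_inj x_surj [E [e [ce ne]]].
pose y b := sval (cid (x_surj b)).
have yK b : x *: y b = b by rewrite /y; case: cid.
have y_lin : linear y.
  move=> a u v; apply/eqP; rewrite -subr_eq0; apply/eqP/x_inj.
  rewrite scalerBr scalerDr scalerA mulrC -scalerA !yK.
  by rewrite subrr.
have [Y [Yc Y0]] := lift_exists (mk_linear y_lin) E E.
pose X j := @GRing.scale _ (res_mod E j) x.
have X_lin j : linear (X j).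
  by move=> a u v; rewrite /X scalerDr scalerA mulrC -scalerA.
have Xc : chain_map (E := E) (E' := E) (fun j => mk_linear (X_lin j)).
  by move=> j u; rewrite /= /X linearZ.
(* Here [Y] lifts the inverse of x. A cocycle u killed by x^(t+1) is cohomologous to x Y(u), which
   is already killed by x^t. *)
suff nil t (u : res_mod E i) : cocycle u -> x ^+ t *: u = 0 -> coboundary u.
  by have [tu du] := ce; have [t tu0] := tu x Gx; apply: ne; apply: nil tu0.
elim: t u => [|t IHt] u cu; first by rewrite scale1r => ->; apply: coboundary0.
move=> xu0; pose w := x *: Y i u.
have -> : u = w - (w - u) by rewrite opprB addrC subrK.
apply: coboundaryB.
  apply: IHt.
    by have := cocycle_map Xc (cocycle_map Yc cu).
  by rewrite /w scalerA -exprSr -linearZ xu0 linear0.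
have /= := comp_lift_coboundary Yc Xc (@id_chain_map _ E) _ cu; apply=> z.
by rewrite /= Y0 /X /= -linearZ yK.
Qed.

End PowerTorsion.

(** * Mapping fibers and the connecting isomorphism *)

Section Fiber.
Variable R : comNzRingType.
Variables (A B C : lmodType R) (f : {linear A -> B}) (g : {linear B -> C}).
Hypotheses (f_inj : injective f) (fg_exact : forall b, g b = 0 <-> exists a, b = f a)
  (g_surj : forall c, exists b, c = g b).
Variables (EB : injective_resolution B) (EC : injective_resolution C).
Variable F : forall i, {linear res_mod EB i -> res_mod EC i}.
Hypotheses (Fc : chain_map F)
  (F_aug : forall x, F 0 (res_aug EB x) = res_aug EC (g x)).

(** The mapping fiber (shifted cone) of the lift [F] of g. Degree 0 has a single factor because EC
    starts in degree 0. It is an injective resolution of A = ker g, obtained from resolutions of B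
    and C alone. *)
Definition fiber_mod (i : nat) : lmodType R :=
  match i with
  | 0 => res_mod EB 0
  | j.+1 => (res_mod EB j.+1 * res_mod EC j)%type : lmodType R
  end.

Lemma fiber_d0_lin : linear
  (fun b => (res_d EB 0 b, F 0 b) : (res_mod EB 1 * res_mod EC 0)%type).
Proof. by move=> a u v; rewrite !linearP. Qed.

Lemma fiber_dS_lin i : linear
  (fun p : (res_mod EB i.+1 * res_mod EC i)%type =>
    (res_d EB i.+1 p.1, F i.+1 p.1 - res_d EC i p.2)
      : (res_mod EB i.+2 * res_mod EC i.+1)%type).
Proof.
move=> a u v; rewrite /= !linearP /=; congr (_, _).
by rewrite addrACA -scalerDr.
Qed.

Definition fiber_d (i : nat) : {linear fiber_mod i -> fiber_mod i.+1} :=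
  match i return {linear fiber_mod i -> fiber_mod i.+1} with
  | 0 => mk_linear fiber_d0_lin
  | j.+1 => mk_linear (@fiber_dS_lin j)
  end.

Lemma fiber_aug_lin : linear (res_aug EB \o f : A -> fiber_mod 0).
Proof. by move=> a u v; rewrite /= !linearP. Qed.

Lemma injective_module_prod (M N : lmodType R) :
  injective_module M -> injective_module N ->
  injective_module ((M * N)%type : lmodType R).
Proof.
move=> injM injN U V j h j_inj.
have l1 : linear (fun u => (h u).1) by move=> a u v; rewrite linearP.
have l2 : linear (fun u => (h u).2) by move=> a u v; rewrite linearP.
have [k1 k1E] := injM U V j (mk_linear l1) j_inj.
have [k2 k2E] := injN U V j (mk_linear l2) j_inj.
have l : linear (fun v => (k1 v, k2 v)) by move=> a u v; rewrite !linearP.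
exists (mk_linear l) => u.
by rewrite /= k1E k2E /=; case: (h u).
Qed.

Lemma fiber_injective i : injective_module (fiber_mod i).
Proof.
case: i => [|i]; first exact: res_injective.
exact: injective_module_prod (@res_injective _ _ EB _) (@res_injective _ _ EC _).
Qed.

Lemma fiber_aug_inj : injective (mk_linear fiber_aug_lin).
Proof. by move=> u v /= /res_aug_inj/f_inj. Qed.

Lemma fiber_exact0 (e : fiber_mod 0) :
  fiber_d 0 e = 0 <-> exists x, e = mk_linear fiber_aug_lin x.
Proof.
split=> [[/res_exact0 [b ->]]|[x ->]] /=.
  rewrite F_aug -(linear0 (res_aug EC)) => /res_aug_inj/fg_exact [x ->].
  by exists x.
by rewrite res_d_aug F_aug (fg_exact _).2 ?linear0 //; exists x.
Qed.

Lemma fiber_exactS i (e : fiber_mod i.+1) :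
  fiber_d i.+1 e = 0 <-> exists e', e = fiber_d i e'.
Proof.
split; last first.
  case: i e => [|i] e [e' ->] /=; rewrite res_dd Fc ?subrr //.
  by rewrite linearB -Fc res_dd subr0 subrr.
case: e => b c /= [db0 /eqP]; rewrite subr_eq0 => /eqP Fb.
have /res_exactS [b' bE] := db0; rewrite {}bE in Fb db0 *.
have : res_d EC i (c - F i b') = 0 by rewrite linearB -Fc -Fb subrr.
case: i b c b' db0 Fb => [|i] b c b' db0 Fb.
  move/res_exact0 => [z]; have [y ->] := g_surj z; rewrite -F_aug => cE.
  exists (b' + res_aug EB y); rewrite /= !linearD res_d_aug addr0 -cE.
  by rewrite addrC subrK.
move=> /res_exactS [c' cE]; exists (b', - c'); rewrite /= linearN opprK -cE.
by rewrite addrC subrK.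
Qed.

Definition fiber_res : injective_resolution A :=
  InjectiveResolution fiber_injective fiber_aug_inj fiber_exact0 fiber_exactS.

End Fiber.

Section LongExact.
Variable R : comNzRingType.
Variables (A B C : lmodType R) (f : {linear A -> B}) (g : {linear B -> C}).
Hypotheses (f_inj : injective f) (fg_exact : forall b, g b = 0 <-> exists a, b = f a)
  (g_surj : forall c, exists b, c = g b).
Variables (EB : injective_resolution B) (EC : injective_resolution C).
Variable G : R -> Prop.
Hypothesis B_eq0 : forall i, ~ cohomology_neq0 G B i.

Lemma acyclic_coboundary i (e : res_mod EB i) : cocycle G e -> coboundary G e.
Proof. by move=> ce; apply: contrapT => ne; apply: (B_eq0 (i := i)); exists EB, e. Qed.

Lemma tors_pair (M N : lmodType R) (u : M) (v : N) :
  tors G ((u, v) : (M * N)%type) <-> tors G u /\ tors G v.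
Proof.
split=> [tuv|[tu tv] a Ga].
  by split=> a Ga; have [t [tu tv]] := tuv a Ga; exists t.
have [s su] := tu a Ga; have [t tv0] := tv a Ga; exists (s + t)%N.
congr (_, _); first by rewrite addnC exprD -scalerA su scaler0.
by rewrite exprD -scalerA tv0 scaler0.
Qed.

(** Computed in the mapping fiber. Since B is acyclic, the first component of a cocycle (b, c) is b
    = d b' with b' torsion, so (b, c) is cohomologous to (0, c - F b'). Conversely c goes to (0,
    c). *)
Lemma connecting_neq0 i : cohomology_neq0 G A i.+1 <-> cohomology_neq0 G C i.
Proof.
have [F [Fc F_aug]] := lift_exists g EB EC.
pose EA := fiber_res f_inj fg_exact g_surj Fc F_aug.
split.
  move=> /(cohomology_neq0_any EA) [[b c] [[/tors_pair [tb tc] dbc] nbc]].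
  have [db /eqP] : (res_d EB i.+1 b, F i.+1 b - res_d EC i c) = (0, 0) := dbc.
  clear dbc; rewrite subr_eq0 => /eqP Fb.
  have [b' [tb' bE]] : coboundary G b by apply: acyclic_coboundary.
  exists EC, (c - F i b'); split.
    split; first by apply: torsB tc _; apply: tors_map.
    by rewrite linearB -Fc -Fb bE subrr.
  move=> bc; apply: nbc; move: bc.
  case: i b c b' tb tc db Fb tb' bE => [|i] b c b' tb tc db Fb tb' bE /=.
    move/eqP; rewrite subr_eq0 => /eqP cE; exists b'; split=> //.
    by rewrite bE cE.
  move=> [c' [tc' cE]]; exists (b', - c'); split.
    by apply/tors_pair; split=> //; apply: torsN.
  by rewrite /= linearN opprK -cE bE addrC subrK.
move=> /(cohomology_neq0_any EC) [c [[tc dc] nc]].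
exists EA, (0, c); split.
  split; first by apply/tors_pair; split=> //; apply: tors0.
  by rewrite /= !linear0 dc subr0.
case: i c tc dc nc => [|i] c tc dc nc /= [].
  move=> b [tb [/esym db cE]]; apply: nc.
  by rewrite /= cE (acyclic_coboundary (i := 0) (conj tb db)) linear0.
move=> [b c'] [/tors_pair [tb tc'] /= [/esym db cE]]; apply: nc.
have [b' [tb' bE]] : coboundary G b by apply: acyclic_coboundary.
exists (F i b' - c'); split; first by apply: torsB tc'; apply: tors_map.
by rewrite cE bE linearB Fc.
Qed.

Lemma sub_acyclic_cohomology0 : ~ cohomology_neq0 G A 0.
Proof.
have [F [Fc F_aug]] := lift_exists g EB EC.
pose EA := fiber_res f_inj fg_exact g_surj Fc F_aug.
move=> /(cohomology_neq0_any EA) [b [[tb [db Fb]] nb]].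
by apply: nb; apply: (acyclic_coboundary (i := 0)).
Qed.

End LongExact.

(** * Coinduction to a polynomial extension *)

(** Serves twice: it supplies the resolutions that the long exact sequence asks for, and its bound
    makes cd finite. *)
Definition resolutions_of_length (A : comNzRingType) (d : nat) : Prop :=
  forall M : lmodType A, exists E : injective_resolution M,
  forall i (e : res_mod E i), (d < i)%N -> e = 0.

(** S is A[x] up to an explicit isomorphism, so that multivariate polynomial rings can be treated as
    univariate ones over a smaller ring. *)
Record poly_ext (A S : comNzRingType) (phi : {rmorphism A -> S}) (x : S) := PolyExt {
  of_poly : {rmorphism {poly A} -> S};
  to_poly : {rmorphism S -> {poly A}};
  of_polyK : cancel of_poly to_poly;
  to_polyK : cancel to_poly of_poly;
  of_polyC : forall a, of_poly a%:P = phi a;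
  of_polyX : of_poly 'X = x
}.

Section PolyExtension.
Variables (A S : comNzRingType) (phi : {rmorphism A -> S}) (x : S).
Variable ext : poly_ext phi x.

Local Notation ofp := (of_poly ext).
Local Notation top := (to_poly ext).

Lemma to_polyC a : top (phi a) = a%:P.
Proof. by rewrite -(of_polyC ext) of_polyK. Qed.

Lemma to_polyX : top x = 'X.
Proof. by have := of_polyK ext 'X; rewrite (of_polyX ext). Qed.

Lemma poly_ext_expand s n : (size (top s) <= n)%N ->
  s = \sum_(k < n) phi (top s)`_k * x ^+ k.
Proof.
move=> le_n; rewrite -[in LHS](to_polyK ext s).
rewrite {1}(_ : top s = \sum_(k < n) (top s)`_k *: 'X^k).
  rewrite rmorph_sum; apply: eq_bigr => k _.
  by rewrite -mul_polyC rmorphM /= of_polyC rmorphXn /= of_polyX.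
rewrite -poly_def; apply/polyP=> k; rewrite coef_poly.
by case: ltnP => // le_nk; rewrite nth_default // (leq_trans le_n).
Qed.

Section Coind.
Variable M : lmodType A.
Implicit Types f g : coind phi M.

Lemma coind_ext f g : (forall k, f (x ^+ k) = g (x ^+ k)) -> f = g.
Proof.
move=> fg; apply: coind_eq => s; rewrite (@poly_ext_expand s _ (leqnn _)).
by rewrite !coind_sum; apply: eq_bigr => k _; rewrite !coindZ fg.
Qed.

Variable u : nat -> M.

Let seq_fun (s : S) : M := \sum_(k < size (top s)) (top s)`_k *: u k.

Let seq_funE s n : (size (top s) <= n)%N ->
  seq_fun s = \sum_(k < n) (top s)`_k *: u k.
Proof.
move=> le_n; rewrite /seq_fun (big_ord_widen n (fun k => (top s)`_k *: u k) le_n).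
rewrite big_mkcond; apply: eq_bigr => k _; case: ltnP => // le_k.
by rewrite nth_default // scale0r.
Qed.

Let seq_fun_linear a s t : seq_fun (phi a * s + t) = a *: seq_fun s + seq_fun t.
Proof.
have topE : top (phi a * s + t) = a *: top s + top t.
  by rewrite rmorphD rmorphM /= to_polyC mul_polyC.
pose n := maxn (size (top (phi a * s + t))) (maxn (size (top s)) (size (top t))).
rewrite !(@seq_funE _ n) ?leq_max ?leqnn ?orbT //.
rewrite scaler_sumr -big_split /=; apply: eq_bigr => k _.
by rewrite topE coefD coefZ scalerDl scalerA.
Qed.

(** As S is free over A on the powers of x, Hom_A(S, M) is the module of all sequences in M. With
    [coind_ext], this lets every question about it be settled term by term. *)
Lemma coind_of_seq : exists f, forall k, f (x ^+ k) = u k.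
Proof.
exists (Coind seq_fun_linear) => k /=.
rewrite /seq_fun rmorphXn /= to_polyX size_polyXn big_ord_recr /=.
rewrite coefXn eqxx scale1r big1 ?add0r // => j _.
by rewrite coefXn ltn_eqF // scale0r.
Qed.

End Coind.

Lemma coind_exact (M N P : lmodType A) (h : {linear M -> N}) (k : {linear N -> P}) :
  (forall v, k v = 0 <-> exists u, v = h u) ->
  forall f, coind_map phi k f = 0 <-> exists g, f = coind_map phi h g.
Proof.
move=> hk f; split=> [kf0|[g ->]]; last first.
  by apply: coind_eq => s; rewrite !coind_mapE; apply/hk; exists (g s).
have /choice [u uE] : forall i, exists u, f (x ^+ i) = h u.
  by move=> i; apply/hk; rewrite -coind_mapE kf0.
have [g gE] := coind_of_seq u.
by exists g; apply: coind_ext => i; rewrite coind_mapE gE uE.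
Qed.

Lemma coind_map_inj (M N : lmodType A) (h : {linear M -> N}) :
  injective h -> injective (coind_map phi h).
Proof.
move=> h_inj f g fg; apply: coind_eq => s; apply: h_inj.
by rewrite -!coind_mapE fg.
Qed.

Section CoindResolution.
Variables (M : lmodType A) (E : injective_resolution M).

Definition coind_res : injective_resolution (coind phi M) :=
  @InjectiveResolution S (coind phi M) (fun i => coind phi (res_mod E i))
    (fun i => coind_map phi (res_d E i)) (coind_map phi (res_aug E))
    (fun i => @coind_injective _ _ phi _ (@res_injective _ _ E i))
    (coind_map_inj (@res_aug_inj _ _ E))
    (coind_exact (@res_exact0 _ _ E))
    (fun i => coind_exact (@res_exactS _ _ E i)).

End CoindResolution.

Section CoindUnit.
Variable M : lmodType S.
Local Notation CM := (coind phi (restr phi M)).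

Lemma coind_unit_subproof (m : M) a s t :
  (phi a * s + t) *: m = a *: (s *: m : restr phi M) + (t *: m : restr phi M).
Proof. by rewrite restrE scalerDl scalerA. Qed.

Lemma coind_unit_linear : linear
  (fun m => @Coind A S phi (restr phi M) (fun s => s *: m) (coind_unit_subproof m) : CM).
Proof.
move=> a u v; apply: coind_eq => s.
by rewrite coind_addE coind_scaleE /= scalerDr scalerA mulrC.
Qed.

Definition coind_unit : {linear M -> CM} := mk_linear coind_unit_linear.

Lemma coind_unit_inj : injective coind_unit.
Proof.
move=> u v uv; have := congr1 (fun f : CM => f 1) uv.
by rewrite /= !scale1r.
Qed.

(* The kernel of this difference operator consists of the S-linear maps. *)
Lemma coind_diff_subproof (f : CM) a s t :
  (f (x * (phi a * s + t)) : M) - x *: (f (phi a * s + t) : M) =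
  a *: ((f (x * s) : M) - x *: (f s : M) : restr phi M) +
  ((f (x * t) : M) - x *: (f t : M) : restr phi M).
Proof.
rewrite mulrDr mulrCA !coindP !restrE scalerBr scalerDr opprD addrACA.
by rewrite !scalerA [x * phi a]mulrC.
Qed.

Lemma coind_diff_linear : linear
  (fun f : CM => @Coind A S phi (restr phi M)
    (fun s => (f (x * s) : M) - x *: (f s : M)) (coind_diff_subproof f) : CM).
Proof.
move=> a f g; apply: coind_eq => s.
rewrite !(coind_addE, coind_scaleE) /=.
by rewrite [a * (x * s)]mulrCA scalerDr opprD addrACA.
Qed.

Definition coind_diff : {linear CM -> CM} := mk_linear coind_diff_linear.

Lemma coind_diffE f s : coind_diff f s = f (x * s) - x *: (f s : M) :> M.
Proof. by []. Qed.

Lemma coind_diff_exact f : coind_diff f = 0 <-> exists m, f = coind_unit m.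
Proof.
split=> [f0|[m ->]]; last first.
  by apply: coind_eq => s; rewrite coind_diffE /= scalerA subrr.
exists (f 1); apply: coind_ext => k /=.
elim: k => [|k IHk]; first by rewrite expr0 scale1r.
rewrite exprS -scalerA -IHk; apply/eqP; rewrite -subr_eq0 -coind_diffE f0.
by rewrite coind_0E.
Qed.

(** The values of f on powers of x solve the recursion u_(k+1) = x u_k + g(x^k), from any u_0. *)
Lemma coind_diff_surj (g : CM) : exists f, g = coind_diff f.
Proof.
pose u := fix u k : restr phi M :=
  if k is j.+1 then x *: (u j : M) + (g (x ^+ j) : M) else 0.
have [f fE] := coind_of_seq u.
exists f; apply: coind_ext => k.
by rewrite coind_diffE -exprS !fE /= addrC addKr.
Qed.

End CoindUnit.

(** M is the kernel of the surjection [coind_diff] between two copies of Hom_A(S, M); the mapping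
    fiber of its lift to coinduced resolutions is one degree longer. *)
Lemma resolutions_of_length_ext d :
  resolutions_of_length A d -> resolutions_of_length S d.+1.
Proof.
move=> hA M; have [E EP] := hA (restr phi M).
have [F [Fc F_aug]] := lift_exists (coind_diff M) (coind_res E) (coind_res E).
exists (fiber_res (@coind_unit_inj M) (@coind_diff_exact M) (@coind_diff_surj M) Fc F_aug).
have E0 i (f : coind phi (res_mod E i)) : (d < i)%N -> f = 0.
  by move=> di; apply: coind_eq => s; apply: EP.
case=> [//|i] [f g] di /=.
by rewrite (E0 _ f (ltnW di)) (E0 _ g).
Qed.

Variables (G : A -> Prop) (G' : S -> Prop).
Hypothesis G'E : forall s, G' s <-> (exists2 a, G a & s = phi a) \/ s = x.

(** On sequences x acts by the shift, so being killed by a power of x means finite support, while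
    elements of A act termwise. *)
Lemma tors_coind (M : lmodType A) (f : coind phi M) :
  tors G' f <-> (exists n, forall k, (n <= k)%N -> f (x ^+ k) = 0) /\
               (forall k, tors G (f (x ^+ k))).
Proof.
split=> [tf|[[n f0] tf] s].
  split.
    have [n xf] := tf x ((G'E x).2 (or_intror erefl)); exists n => k nk.
    by rewrite -(subnK nk) addnC exprD -coind_scaleE xf.
  move=> k a Ga; have [|t af] := tf (phi a).
    by apply/G'E; left; exists a.
  by exists t; rewrite -coindZ rmorphXn -coind_scaleE af.
move=> /G'E [[a Ga ->]|->]; last first.
  exists n; apply: coind_ext => k; rewrite coind_scaleE -exprD.
  by rewrite f0 ?leq_addr.
have /choice [t tE] k := tf k a Ga.
(* Only finitely many terms are nonzero, so the sum of their exponents works for all of them. *)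
exists (\sum_(k < n) t k)%N; apply: coind_ext => k.
rewrite coind_scaleE -rmorphXn coindZ coind_0E.
case: (ltnP k n) => [kn|/f0 ->]; last by rewrite scaler0.
by rewrite (bigD1 (Ordinal kn)) //= addnC exprD -scalerA tE scaler0.
Qed.

Lemma coind_cohomology_neq0 (M : lmodType A) (E : injective_resolution M) i :
  cohomology_neq0 G' (coind phi M) i <-> cohomology_neq0 G M i.
Proof.
split.
  move=> /(cohomology_neq0_any (coind_res E)) [f [[/tors_coind [[n f0] tf] df] nf]].
  exists E; apply: contrapT => /forallNP no; apply: nf.
  have bf k : coboundary G (E := E) (f (x ^+ k)).
    apply: contrapT => nb; apply: (no (f (x ^+ k))); split=> //; split=> //.
    by rewrite -[LHS]/(coind_map phi (res_d E i) f (x ^+ k)) [coind_map _ _ _]df.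
  case: i f f0 tf df no bf => [|i] f f0 tf df no bf /=.
    by apply: coind_ext.
  have /choice [u uE] := bf.
  (* The termwise preimages are cut off beyond the support of f, to keep g torsion for x. *)
  have [g gE] := coind_of_seq (fun k => if (k < n)%N then u k else 0).
  exists g; split.
    apply/tors_coind; split.
      by exists n => k nk; rewrite gE ltnNge nk.
    by move=> k; rewrite gE; case: ifP => _; [exact: (uE k).1 | exact: tors0].
  apply: coind_ext => k; rewrite coind_mapE gE.
  by case: ltnP => [_|/f0 ->]; [exact: (uE k).2 | rewrite linear0].
move=> /(cohomology_neq0_any E) [e [[te de] ne]].
have [f fE] := @coind_of_seq (res_mod E i) (fun k => if k == 0%N then e else 0).
exists (coind_res E), f; split.
  split.
    apply/tors_coind; split; first by exists 1%N => k; rewrite fE; case: k.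
    by move=> k; rewrite fE; case: eqP => _ //; apply: tors0.
  apply: coind_ext => k; rewrite coind_mapE fE coind_0E.
  by case: eqP => _ //; rewrite linear0.
case: i e te de ne f fE => [|i] e te de ne f fE /=.
  by move=> f0; apply: ne; have := fE 0%N; rewrite f0 coind_0E.
move=> [g [/tors_coind [_ tg] fg]]; apply: ne.
exists (g (x ^+ 0)); split=> //.
by have /= <- := fE 0%N; rewrite fg coind_mapE.
Qed.
End PolyExtension.

(** * Adjoining one variable *)

Section ConstantCoefficient.
Variables (A S : comNzRingType) (phi : {rmorphism A -> S}) (x : S).
Variable ext : poly_ext phi x.
Local Notation top := (to_poly ext).

Definition const_coef : {rmorphism S -> A} := horner_eval 0 \o top.

Lemma const_coefC a : const_coef (phi a) = a.
Proof. by rewrite /= to_polyC horner_evalE hornerC. Qed.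

Lemma const_coefX : const_coef x = 0.
Proof. by rewrite /= to_polyX horner_evalE hornerX. Qed.

Lemma to_poly_inj : injective top.
Proof. exact: can_inj (to_polyK ext). Qed.

Lemma mul_x_eq0 s : x * s = 0 -> s = 0.
Proof.
move=> xs0; apply: to_poly_inj; rewrite rmorph0; apply/polyP=> k.
have := congr1 (fun s => (top s)`_k.+1) xs0.
by rewrite rmorphM rmorph0 /= to_polyX mulrC coefMX !coef0.
Qed.

Lemma const_coef_eq0 s : const_coef s = 0 -> exists t, s = x * t.
Proof.
rewrite /= horner_evalE => /eqP/factor_theorem [q qE].
exists (of_poly ext q); apply: to_poly_inj.
by rewrite rmorphM /= to_polyX of_polyK qE subr0 mulrC.
Qed.
End ConstantCoefficient.

Section Shift.
Variables (A S : comNzRingType) (phi : {rmorphism A -> S}) (x : S).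
Variable ext : poly_ext phi x.
Local Notation c0 := (const_coef ext).
Local Notation HS := (coind phi (restr phi S^o)).
Local Notation delta := (coind_diff phi x S^o).
Local Notation unit := (coind_unit phi S^o).

Lemma poly_const_linear : linear (phi : A^o -> restr phi S^o).
Proof. by move=> a u v; rewrite restrE rmorphD rmorphM. Qed.

Definition poly_const : {linear A^o -> restr phi S^o} := mk_linear poly_const_linear.

Lemma poly_const_inj : injective (coind_map phi poly_const).
Proof. exact/coind_map_inj/(can_inj (const_coefC ext)). Qed.

(* The power series in x^-1 with finitely many positive powers of x: [v] is  *)
(* encoded by sending [s] to the polynomial part of [s * v].                 *)
Definition laurent_mem (f : HS) : Prop :=
  exists g, delta f = coind_map phi poly_const g.

Lemma laurent_mem0 : laurent_mem 0.
Proof. by exists 0; rewrite !linear0. Qed.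

Lemma laurent_mem_lin a f f' :
  laurent_mem f -> laurent_mem f' -> laurent_mem (a *: f + f').
Proof.
by move=> [g gE] [g' gE']; exists (a *: g + g'); rewrite [LHS]linearP [RHS]linearP gE gE'.
Qed.

Definition laurent : lmodType S := submod_type (submod_of laurent_mem0 laurent_mem_lin).

(** The residue pairing: s is sent to the coefficient of 1/x in s * v. *)
Definition laurent_part (v : laurent) : coind phi A^o := sval (cid (submod_ofP v)).

Lemma laurent_partE (v : laurent) :
  coind_map phi poly_const (laurent_part v) = delta (val v).
Proof. by rewrite /laurent_part; case: cid => /= g ->. Qed.

Lemma laurent_part_linear : linear laurent_part.
Proof.
move=> a u v; apply: poly_const_inj.
by rewrite [RHS]linearP !laurent_partE [val _]linearP [LHS]linearP.
Qed.

Lemma laurent_unit (r : S^o) : laurent_mem (unit r).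
Proof.
by exists 0; rewrite linear0; apply/(coind_diff_exact ext); exists r.
Qed.

Lemma laurent_of_poly_linear :
  linear (fun r : S^o => submod_in laurent_mem0 laurent_mem_lin (laurent_unit r) : laurent).
Proof. by move=> a u v; apply: val_inj; rewrite [RHS]linearP !submod_inK; exact: linearP. Qed.

Lemma laurent_of_poly_inj : injective (mk_linear laurent_of_poly_linear).
Proof. by move=> u v /(congr1 val); rewrite !submod_inK => /coind_unit_inj. Qed.

Lemma laurent_exact (v : laurent) : mk_linear laurent_part_linear v = 0 <->
  exists r, v = mk_linear laurent_of_poly_linear r.
Proof.
split=> [v0|[r ->]].
  have /(coind_diff_exact ext) [r vE] : delta (val v) = 0.
    have pv0 : laurent_part v = 0 := v0.
    by rewrite -laurent_partE pv0 linear0.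
  by exists r; apply: val_inj; rewrite submod_inK.
apply: poly_const_inj; rewrite linear0 laurent_partE submod_inK.
by apply/(coind_diff_exact ext); exists r.
Qed.

Lemma laurent_part_surj (g : coind phi A^o) :
  exists v, g = mk_linear laurent_part_linear v.
Proof.
have [f fE] := coind_diff_surj ext (coind_map phi poly_const g).
have lf : laurent_mem f by exists g.
exists (submod_in laurent_mem0 laurent_mem_lin lf).
by apply: poly_const_inj; rewrite laurent_partE submod_inK.
Qed.

(** If x v = 0, the difference operator sends v to s |-> - x v(s). Its values must be constants, yet
    vanish at x = 0; so they are zero, and x is not a zero divisor. *)
Lemma laurent_mulx_inj (v : laurent) : x *: v = 0 -> v = 0.
Proof.
move=> xv0; have xv s : (val v : HS) (x * s) = 0.
  by rewrite -coind_scaleE -[x *: val v]linearZ xv0 linear0 coind_0E.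
apply: val_inj; rewrite linear0; apply: coind_eq => s.
have := congr1 (fun f : HS => f s) (laurent_partE v).
rewrite coind_mapE coind_diffE xv sub0r.
move: (laurent_part v s) => c gE.
have {}gE : phi c = - (x * (val v : HS) s) := gE.
have := congr1 c0 gE; rewrite const_coefC rmorphN rmorphM const_coefX mul0r oppr0.
move=> cE; move: gE; rewrite cE rmorph0 => /esym/eqP.
by rewrite oppr_eq0 => /eqP/(mul_x_eq0 ext).
Qed.

Lemma laurent_mulx_surj (v : laurent) : exists w, v = x *: w.
Proof.
pose b := (val v : HS) 1 : S.
(* With b the polynomial part of v, this w is the polynomial part of v / x; the constant term of b
   becomes the residue of v / x. *)
have [w wE] : exists w, b - phi (c0 b) = x * w.
  by apply: (const_coef_eq0 (ext := ext)); rewrite rmorphB const_coefC subrr.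
have [f fE] := @coind_of_seq _ _ _ _ ext (restr phi S^o)
  (fun k => if k is j.+1 then (val v : HS) (x ^+ j) else w).
have xf : x *: f = val v.
  by apply: (coind_ext ext) => k; rewrite coind_scaleE -exprS fE.
have lf : laurent_mem f.
  have [g gE] := @coind_of_seq _ _ _ _ ext A^o
    (fun k => if k is j.+1 then laurent_part v (x ^+ j) else c0 b).
  exists g.
  apply: (coind_ext ext) => k; rewrite coind_diffE coind_mapE -exprS fE gE.
  case: k => [|k]; last first.
    by rewrite -coind_mapE laurent_partE coind_diffE -exprS fE.
  rewrite fE expr0; change (b - x * w = phi (c0 b)).
  by rewrite -wE opprB addrC subrK.
exists (submod_in laurent_mem0 laurent_mem_lin lf).
by apply: val_inj; rewrite -xf.
Qed.

Variables (G : A -> Prop) (G' : S -> Prop).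
Hypothesis G'E : forall s, G' s <-> (exists2 a, G a & s = phi a) \/ s = x.
Variables (d : nat).
Hypothesis resA : resolutions_of_length A d.

Lemma laurent_acyclic i : ~ cohomology_neq0 G' laurent i.
Proof.
apply: (bijective_cohomology_eq0 (x := x)).
- by apply/G'E; right.
- exact: laurent_mulx_inj.
- exact: laurent_mulx_surj.
Qed.

Lemma poly_cohomology_neq0S i :
  cohomology_neq0 G' S^o i.+1 <-> cohomology_neq0 G A^o i.
Proof.
have [EV _] := resolutions_of_length_ext ext resA laurent.
have [EA _] := resA A^o.
rewrite -(coind_cohomology_neq0 ext G'E EA).
exact: (connecting_neq0 laurent_of_poly_inj laurent_exact laurent_part_surj
  EV (coind_res ext EA) laurent_acyclic).
Qed.

Lemma poly_cohomology_eq0 : ~ cohomology_neq0 G' S^o 0.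
Proof.
have [EV _] := resolutions_of_length_ext ext resA laurent.
have [EA _] := resA A^o.
exact: (sub_acyclic_cohomology0 laurent_of_poly_inj laurent_exact laurent_part_surj
  EV (coind_res ext EA) laurent_acyclic).
Qed.
End Shift.

Section Specialization.
Variables (A S R : comNzRingType) (phi : {rmorphism A -> S}) (x : S).
Variable ext : poly_ext phi x.
Variables (rho : {rmorphism R -> S}) (d : nat) (G : R -> Prop).
Hypothesis resR : resolutions_of_length R d.

Definition specialize : {rmorphism R -> A} := const_coef ext \o rho.

(** In 0 -> S -> S -> A -> 0, with first map multiplication by x and second x |-> 0, both copies of
    S are acyclic as R-modules, hence so is A. *)
Lemma specialize_acyclic :
  (forall i, ~ cohomology_neq0 G (restr rho S^o) i) ->
  forall i, ~ cohomology_neq0 G (restr specialize A^o) i.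
Proof.
move=> S0 i.
have mulx_lin : linear (fun s : restr rho S^o => x * s : restr rho S^o).
  by move=> a u v; rewrite mulrDr; congr (_ + _); exact: mulrCA.
have c0_lin : linear (const_coef ext : restr rho S^o -> restr specialize A^o).
  by move=> a u v; rewrite !restrE rmorphD rmorphM.
have mulx_inj : injective (mk_linear mulx_lin).
  move=> u v /= /eqP; rewrite -subr_eq0 -mulrBr => /eqP/(mul_x_eq0 ext)/eqP.
  by rewrite subr_eq0 => /eqP.
have exact_c0 b : mk_linear c0_lin b = 0 <-> exists a, b = mk_linear mulx_lin a.
  split.
    by move=> b0; have [t bE] := @const_coef_eq0 _ _ _ _ ext b b0; exists t.
  move=> [a ->]; change (const_coef ext (x * a) = 0).
    by rewrite rmorphM const_coefX mul0r.
have c0_surj c : exists b, c = mk_linear c0_lin b.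
  by exists (phi c); apply/esym/(const_coefC ext).
have [E _] := resR (restr rho S^o); have [E' _] := resR (restr specialize A^o).
by rewrite -(connecting_neq0 mulx_inj exact_c0 c0_surj E E' S0).
Qed.
End Specialization.

(** * Modules over a field *)

Section FieldModules.
Variable F : comNzRingType.
(** Fieldhood as a property, so that it applies to the ring [{mpoly K[0]}]. *)
Hypothesis invF : forall a : F, a <> 0 -> exists b, b * a = 1.

Section Extension.
Variables (U V M : lmodType F) (f : {linear U -> V}) (g : {linear U -> M}).
Hypothesis f_inj : injective f.

(** Graphs of partial linear maps from V to M that extend g along f; Zorn's lemma is applied to
    them. *)
Record extension_graph (P : V * M -> Prop) : Prop := ExtensionGraph {
  graph_lin : forall a p q, P p -> P q -> P (a *: p.1 + q.1, a *: p.2 + q.2);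
  graph_fun : forall m, P (0, m) -> m = 0;
  graph_sub : forall u, P (f u, g u)
}.

Lemma base_graph : extension_graph (fun p => exists u, p = (f u, g u)).
Proof.
split=> [a _ _ [u ->] [v ->]|m [u [fu ->]]|u]; last by exists u.
  by exists (a *: u + v); rewrite !linearP.
by have -> : u = 0; [apply: f_inj; rewrite linear0 | rewrite linear0].
Qed.

Lemma maximal_graph : exists2 P, extension_graph P &
  forall Q, extension_graph Q -> (forall p, P p -> Q p) -> forall p, Q p -> P p.
Proof.
pose T := {P : V * M -> Prop | extension_graph P}.
pose le (P Q : T) := `[< forall p, sval P p -> sval Q p >].
have [] := @Zorn T le.
- by move=> P; apply/asboolP.
- move=> P Q S /asboolP PQ /asboolP QS; apply/asboolP => p /PQ; exact: QS.
- move=> [P gP] [Q gQ] /asboolP /= PQ /asboolP /= QP.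
  have E : P = Q by apply/funext => p; apply/propext; split; [exact: PQ | exact: QP].
  by move: gP gQ; rewrite E => gP gQ; congr exist; exact: Prop_irrelevance.
- move=> C totC.
  (* The base graph is joined to the union so that the empty chain also has an upper bound. *)
  pose W p := (exists u, p = (f u, g u)) \/ exists2 Q : T, C Q & sval Q p.
  have gW : extension_graph W.
    split=> [a p q|m|u]; last by left; exists u.
      case=> [bp|[P CP Pp]] [bq|[Q CQ Qq]].
      + by left; exact: (graph_lin base_graph).
      + right; exists Q => //; apply: (graph_lin (svalP Q)) => //.
        by case: bp => u ->; exact: (graph_sub (svalP Q)).
      + right; exists P => //; apply: (graph_lin (svalP P)) => //.
        by case: bq => u ->; exact: (graph_sub (svalP P)).
      + have /orP [/asboolP PQ|/asboolP QP] : le P Q || le Q P.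
          by apply/orP; exact: totC.
        by right; exists Q => //; apply: (graph_lin (svalP Q)) => //; exact: PQ.
      by right; exists P => //; apply: (graph_lin (svalP P)) => //; exact: QP.
    case; first exact: (graph_fun base_graph).
    by move=> [P _]; exact: (graph_fun (svalP P)).
  exists (exist _ W gW) => P CP; apply/asboolP => p Pp.
  by right; exists P.
move=> [P gP] maxP; exists P => // Q gQ PQ.
by have /(congr1 sval) /= <- := maxP (exist _ Q gQ) (asboolT PQ).
Qed.

Lemma extension_exists : exists h : {linear V -> M}, forall u, h (f u) = g u.
Proof.
have [P gP maxP] := maximal_graph.
have P0 : P (0, 0) by have := graph_sub gP 0; rewrite !linear0.
have P_scale a v m : P (v, m) -> P (a *: v, a *: m).
  by move=> Pvm; have := graph_lin gP a Pvm P0; rewrite /= !addr0.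
have tot v : exists m, P (v, m).
  apply: contrapT => /forallNP no.
  (* The graph enlarged by v |-> 0. It stays single-valued: a nonzero c could be divided out and
     would put v in the domain of P. *)
  pose Q (p : V * M) := exists c, P (p.1 - c *: v, p.2).
  apply: (no 0); apply: (maxP Q); last by exists 1; rewrite scale1r subrr.
    split=> [a p q [c Pc] [c' Pc']|m [c]|u].
    - exists (a * c + c'); have := graph_lin gP a Pc Pc' => /=.
      by rewrite scalerBr scalerA scalerDl opprD addrACA.
    - rewrite sub0r /= => Pc; have [c0|/eqP/invF [b bc]] := eqVneq c 0.
        by apply: (graph_fun gP); move: Pc; rewrite c0 scale0r oppr0.
      have := P_scale (- b) _ _ Pc; rewrite scaleNr scalerN opprK scalerA bc.
      by rewrite scale1r => /no.
    - by exists 0; rewrite scale0r subr0; exact: graph_sub.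
  by move=> p Pp; exists 0; rewrite scale0r subr0; case: p Pp.
pose h v := sval (cid (tot v)).
have hP v : P (v, h v) by rewrite /h; case: cid.
have P_fun v m m' : P (v, m) -> P (v, m') -> m' = m.
  move=> Pm Pm'; apply/eqP; rewrite -subr_eq0; apply/eqP/(graph_fun gP).
  have := graph_lin gP (-1) Pm Pm'; rewrite /= !scaleN1r addNr.
  by rewrite addrC.
have h_lin : linear h.
  move=> a u v; apply: P_fun (hP _).
  exact: (graph_lin gP a (hP u) (hP v)).
exists (mk_linear h_lin) => u; apply: P_fun (hP _); exact: graph_sub.
Qed.

End Extension.

Lemma field_resolutions : resolutions_of_length F 0.
Proof.
move=> M.
pose X i : lmodType F := if i is 0 then M else 'rV[F]_0.
have X0 i (e : X i.+1) : e = 0 by apply/rowP => - [].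
pose d i : {linear X i -> X i.+1} := \0.
have injX i : injective_module (X i).
  by move=> U V f g f_inj; exact: extension_exists.
have aug_inj : injective (idfun : {linear M -> X 0}) by [].
have ex0 e : d 0 e = 0 <-> exists x, e = (idfun : {linear M -> X 0}) x.
  by split=> // _; exists e.
have exS i e : d i.+1 e = 0 <-> exists e', e = d i e'.
  by split=> // _; exists 0; rewrite [LHS]X0 [RHS]X0.
exists (InjectiveResolution injX aug_inj ex0 exS).
by case=> // i e _; exact: X0.
Qed.

End FieldModules.

(** * Radicals, torsion and the tower of polynomial rings *)

Section RadicalIdeals.
Variable R : comNzRingType.
Implicit Types (I J G : R -> Prop) (x y : R).

Definition is_ideal I : Prop :=
  I 0 /\ forall a x y, I x -> I y -> I (a * x + y).

Lemma idealM I a x : is_ideal I -> I x -> I (a * x).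
Proof. by move=> [I0 I_lin] Ix; rewrite -[_ * _]addr0; apply: I_lin. Qed.

Lemma idealD I x y : is_ideal I -> I x -> I y -> I (x + y).
Proof. by move=> [I0 I_lin] Ix Iy; rewrite -[x]mul1r; apply: I_lin. Qed.

Lemma idealN I x : is_ideal I -> I x -> I (- x).
Proof. by move=> iI Ix; rewrite -mulN1r; apply: idealM. Qed.

Lemma idealB I x y : is_ideal I -> I x -> I y -> I (x - y).
Proof. by move=> iI Ix Iy; apply: idealD => //; apply: idealN. Qed.

Lemma ideal_sum I (T : finType) (P : pred T) (u : T -> R) :
  is_ideal I -> (forall i, P i -> I (u i)) -> I (\sum_(i | P i) u i).
Proof.
move=> iI Iu; apply: (big_ind I) => //; first exact: iI.1.
by move=> x y; apply: idealD.
Qed.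

Lemma ideal_gen_ideal G : is_ideal (ideal_gen G).
Proof.
split; first by exists 0%N, (fun=> 0), (fun=> 0); rewrite big_ord0; split=> // -[].
move=> a x y [r [c [g [Gg ->]]]] [s [c' [g' [Gg' ->]]]].
exists (r + s)%N.
exists (fun i => match split i with inl j => a * c j | inr j => c' j end).
exists (fun i => match split i with inl j => g j | inr j => g' j end).
split; first by move=> i; case: split.
rewrite big_split_ord /= mulr_sumr; congr (_ + _); apply: eq_bigr => i _.
  by rewrite (unsplitK (inl i)) mulrA.
by rewrite (unsplitK (inr i)).
Qed.

Lemma ideal_gen_sub G x : G x -> ideal_gen G x.
Proof.
by move=> Gx; exists 1%N, (fun=> 1), (fun=> x); rewrite big_ord1 mul1r.
Qed.

Lemma ideal_gen_min G I : is_ideal I -> (forall x, G x -> I x) ->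
  forall x, ideal_gen G x -> I x.
Proof.
move=> iI GI x [r [c [g [Gg ->]]]].
by apply: ideal_sum => // i _; apply: idealM => //; apply: GI.
Qed.

Lemma ideal_of_familyP s (b : 'I_s -> R) x : ideal_of_family b x ->
  exists c : 'I_s -> R, x = \sum_i c i * b i.
Proof.
apply: (@ideal_gen_min _ (fun x => exists c : 'I_s -> R, x = \sum_i c i * b i)).
  split; first by exists (fun=> 0); rewrite big1 // => i _; rewrite mul0r.
  move=> a _ _ [c ->] [c' ->]; exists (fun i => a * c i + c' i).
  by rewrite mulr_sumr -big_split; apply: eq_bigr => i _; rewrite mulrDl mulrA.
move=> _ [i ->]; exists (fun j => (j == i)%:R).
rewrite (bigD1 i) //= eqxx mul1r big1 ?addr0 // => j /negbTE ->.
by rewrite mul0r.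
Qed.

Lemma radical_sub I x : I x -> radical I x.
Proof. by exists 1%N. Qed.

Lemma radical_idem I x : radical (radical I) x -> radical I x.
Proof. by move=> [k [l Ixl]]; exists (k * l)%N; rewrite exprM. Qed.

Lemma radical_ideal I : is_ideal I -> is_ideal (radical I).
Proof.
move=> iI; split; first by exists 1%N; exact: iI.1.
move=> a x y [k Ixk] [l Iyl]; exists (k + l)%N.
rewrite exprDn; apply: ideal_sum => // i _; rewrite -mulr_natr mulrC.
apply: idealM => //; have [ki|ik] := leqP k (k + l - i).
  rewrite mulrC exprMn; do 2 apply: idealM => //.
  by rewrite -(subnK ki) exprD; apply: idealM.
have li : (l <= i)%N.
  have ikl : (i <= k + l)%N by rewrite -ltnS ltn_ord.
  by move: ik; rewrite ltn_subLR // [(i + k)%N]addnC ltn_add2l => /ltnW.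
by rewrite -(subnK li) exprD mulrA; apply: idealM.
Qed.

Lemma radical_gen_sub G I : is_ideal I -> (forall x, G x -> radical I x) ->
  forall x, radical (ideal_gen G) x -> radical I x.
Proof.
move=> iI GI x [k xk]; apply: radical_idem; exists k.
by apply: ideal_gen_min xk => //; exact: radical_ideal.
Qed.

Section Torsion.
Variables (M : lmodType R) (e : M).

Lemma annihilator_ideal : is_ideal (fun a => a *: e = 0).
Proof.
split=> [|a x y xe ye]; first by rewrite scale0r.
by rewrite scalerDl -scalerA xe ye scaler0 addr0.
Qed.

(** Pigeonhole: a product of s N + 1 elements of I expands into monomials of that degree in s
    generators, and each monomial contains some generator at least N times. *)
Lemma torsion_of_family s (b : 'I_s -> R) I :
  (forall x, I x -> ideal_of_family b x) ->
  (forall i, exists t, b i ^+ t *: e = 0) -> torsion I e.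
Proof.
move=> Ib /choice [t tE].
pose N := (\sum_i t i)%N.
have bN i n : (N <= n)%N -> b i ^+ n *: e = 0.
  move=> Nn; have tn : (t i <= n)%N by apply: leq_trans Nn; rewrite /N (bigD1 i) ?leq_addr.
  by rewrite -(subnK tn) exprD -scalerA tE scaler0.
exists (s * N).+1; apply: ideal_gen_min annihilator_ideal _ => _ [a [Ia ->]].
have /choice [c cE] i := ideal_of_familyP (Ib _ (Ia i)).
under eq_bigr => i _ do rewrite cE.
rewrite bigA_distr_bigA scaler_suml big1 // => phi _.
rewrite big_split /= -scalerA.
suff -> : (\prod_i b (phi i)) *: e = 0 by rewrite scaler0.
have [l Nl] : exists l, (N <= #|[pred i | phi i == l]|)%N.
  apply/existsP; apply: contraT; rewrite negb_exists => /forallP small.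
  suff : ((s * N).+1 <= s * N)%N by rewrite ltnn.
  rewrite -{1}[(s * N).+1]card_ord -sum1_card.
  rewrite (partition_big phi predT) //=.
  rewrite -[s in (_ <= s * _)%N]card_ord -sum_nat_const.
  apply: leq_sum => l _; rewrite sum1_card; apply: ltnW.
  by have := small l; rewrite -ltnNge.
rewrite (bigID (fun i => phi i == l)) /= mulrC -scalerA.
have -> : \prod_(i | phi i == l) b (phi i) = b l ^+ #|[pred i | phi i == l]|.
  by rewrite -prodr_const; apply: eq_bigr => i /eqP ->.
by rewrite bN ?scaler0.
Qed.

(** The bridge from the section functor of I to [tors]. The family [b] expresses finite generation;
    G need only agree with I up to radical. *)
Lemma torsion_tors s (b : 'I_s -> R) I G : is_ideal I ->
  (forall x, I x -> ideal_of_family b x) ->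
  (forall i, radical (ideal_gen G) (b i)) ->
  (forall x, G x -> radical I x) -> torsion I e <-> tors G e.
Proof.
move=> iI Ib bG GI; split=> [[t te] a Ga|te].
  have [k Ik] := GI a Ga; exists (k * t)%N; rewrite exprM; apply: te.
  apply: ideal_gen_sub; exists (fun=> a ^+ k); split=> //.
  by rewrite prodr_const card_ord.
apply: (torsion_of_family Ib) => i.
by apply: (radical_gen_sub annihilator_ideal _ (bG i)) => x; exact: te.
Qed.
End Torsion.

Lemma local_cohomologyE I G (M : lmodType R) i :
  (forall (N : lmodType R) (e : N), torsion I e <-> tors G e) ->
  local_cohomology_neq0 I M i <-> cohomology_neq0 G M i.
Proof.
move=> IG; split; move=> [E [e [[te de] ne]]]; exists E, e.
  split; first by split=> //; apply/IG.
  case: i e te de ne => [//|i] e te de ne [e' [/IG te' eE]].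
  by apply: ne; exists e'.
split; first by split=> //; apply/IG.
case: i e te de ne => [//|i] e te de ne [e' [/IG te' eE]].
by apply: ne; exists e'.
Qed.

End RadicalIdeals.

Lemma ideal_gen_map (R S : comNzRingType) (phi : {rmorphism R -> S})
    (G : R -> Prop) (I : S -> Prop) : is_ideal I -> (forall x, G x -> I (phi x)) ->
  forall x, ideal_gen G x -> I (phi x).
Proof.
move=> [I0 I_lin] GI; apply: (ideal_gen_min (I := fun x => I (phi x))) => //.
split; first by rewrite rmorph0.
by move=> a x y Ix Iy; rewrite rmorphD rmorphM; apply: I_lin.
Qed.

(** * Multivariate polynomial rings as iterated univariate extensions *)

Section MpolyExtension.
Variable R : comNzRingType.

Lemma muniX n (m : 'X_{1..n.+1}) : muni ('X_[m] : {mpoly R[n.+1]}) =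
  'X_[[multinom m (widen_ord (leqnSn n) i) | i < n]] *: 'X^(m ord_max).
Proof. by rewrite muniE msuppX big_seq1 mcoeffX eqxx scale1r. Qed.

Definition of_poly_mpoly n : {rmorphism {poly {mpoly R[n]}} -> {mpoly R[n.+1]}} :=
  horner_eval ('X_ord_max : {mpoly R[n.+1]}) \o map_poly (@mwiden n R).
Definition muni_rmorphism n : {rmorphism {mpoly R[n.+1]} -> {poly {mpoly R[n]}}} :=
  @muni n R.
Definition mwiden_rmorphism n : {rmorphism {mpoly R[n]} -> {mpoly R[n.+1]}} :=
  @mwiden n R.
Definition mpolyC_rmorphism n : {rmorphism R -> {mpoly R[n]}} := @mpolyC n R.

Lemma of_poly_mpolyE n (p : {poly {mpoly R[n]}}) :
  of_poly_mpoly n p = (map_poly (@mwiden n R) p).['X_ord_max].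
Proof. by []. Qed.

Lemma mpoly_additive_eq n (V : zmodType) (f g : {additive {mpoly R[n]} -> V}) :
  (forall c m, f (c *: 'X_[m]) = g (c *: 'X_[m])) -> f =1 g.
Proof.
move=> fg p; rewrite (mpolyE p) !raddf_sum.
by apply: eq_bigr => m _; exact: fg.
Qed.

Lemma muni_mwiden n (p : {mpoly R[n]}) : muni (mwiden p) = p%:P.
Proof.
apply: (mpoly_additive_eq (f := muni_rmorphism n \o @mwiden n R) (g := @polyC _)).
move=> c m /=; rewrite mwidenZ mwidenX muniZ muniX.
rewrite mnmwiden_ordmax expr0 alg_polyC -mul_polyC -polyCM mul_mpolyC.
by congr (_ *: 'X_[_])%:P; apply/mnmP => i; rewrite mnmE mnmwiden_widen.
Qed.

Lemma muni_ord_max n : muni ('X_ord_max : {mpoly R[n.+1]}) = 'X.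
Proof.
rewrite muniX mnm1E eqxx expr1 (_ : [multinom _ | _ < _] = 0%MM).
  by rewrite mpolyX0 scale1r.
apply/mnmP => i; rewrite mnmE mnm1E mnm0E eq_sym.
by rewrite -val_eqE /= ltn_eqF.
Qed.

Lemma of_poly_mpolyK n : cancel (of_poly_mpoly n) (muni_rmorphism n).
Proof.
move=> p; rewrite -[in LHS](coefK p) poly_def !rmorph_sum -[RHS]coefK poly_def.
apply: eq_bigr => i _; rewrite -!mul_polyC !rmorphM !rmorphXn.
rewrite !of_poly_mpolyE map_polyC hornerC map_polyX hornerX.
by rewrite [muni_rmorphism n _]muni_mwiden [muni_rmorphism n _]muni_ord_max.
Qed.

Lemma muni_rmorphismK n : cancel (muni_rmorphism n) (of_poly_mpoly n).
Proof.
apply: (mpoly_additive_eq (f := of_poly_mpoly n \o muni_rmorphism n) (g := idfun)).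
move=> c m; rewrite -[LHS]/(of_poly_mpoly n (muni (c *: 'X_[m]))) muniZ muniX -!mul_polyC.
rewrite !rmorphM rmorphXn.
rewrite !of_poly_mpolyE !map_polyC !hornerC map_polyX hornerX.
rewrite /= mwidenC mwidenX mpolyXn -mpolyXD mul_mpolyC; congr (_ *: 'X_[_]).
apply/mnmP => i; rewrite mnmDE mulmnE mnm1E.
rewrite [ord_max == i]eq_sym; have [->|ni] := eqVneq i ord_max.
  by rewrite mnmwiden_ordmax mul1n.
have i_n : (i < n)%N.
  by rewrite ltn_neqAle -ltnS ltn_ord andbT; move: ni; rewrite -val_eqE.
have -> : i = widen_ord (leqnSn n) (Ordinal i_n) by apply: val_inj.
by rewrite mnmwiden_widen mnmE mul0n addn0.
Qed.

Lemma mpoly_ext n : poly_ext (mwiden_rmorphism n) ('X_ord_max : {mpoly R[n.+1]}).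
Proof.
apply: (PolyExt (@of_poly_mpolyK n) (@muni_rmorphismK n)).
  by move=> a; rewrite of_poly_mpolyE map_polyC hornerC.
by rewrite of_poly_mpolyE map_polyX hornerX.
Qed.

Lemma mpoly0_const (p : {mpoly R[0]}) : p = (p@_0)%:MP.
Proof.
apply/mpolyP => m; rewrite mcoeffC (_ : m = 0%MM) ?eqxx ?mulr1 //.
by apply/mnmP => - [].
Qed.

Definition mcoeff0_rmorphism n : {rmorphism {mpoly R[n]} -> R} := mcoeff 0%MM.

Lemma mpolyC0K : cancel (mpolyC_rmorphism 0) (mcoeff0_rmorphism 0).
Proof. by move=> a; rewrite /= mcoeffC eqxx mulr1. Qed.

Lemma mcoeff0K : cancel (mcoeff0_rmorphism 0) (mpolyC_rmorphism 0).
Proof. by move=> p; rewrite [RHS]mpoly0_const. Qed.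

Definition of_poly_mpoly1 : {rmorphism {poly R} -> {mpoly R[1]}} :=
  of_poly_mpoly 0 \o map_poly (mpolyC_rmorphism 0).

Definition to_poly_mpoly1 : {rmorphism {mpoly R[1]} -> {poly R}} :=
  map_poly (mcoeff0_rmorphism 0) \o muni_rmorphism 0.

Lemma of_poly_mpoly1K : cancel of_poly_mpoly1 to_poly_mpoly1.
Proof.
move=> p; rewrite /to_poly_mpoly1 /of_poly_mpoly1 /= of_poly_mpolyK.
by apply/polyP => i; rewrite !coef_map; exact: mpolyC0K.
Qed.

Lemma to_poly_mpoly1K : cancel to_poly_mpoly1 of_poly_mpoly1.
Proof.
move=> p; rewrite -[RHS](muni_rmorphismK p); congr (of_poly_mpoly 0 _).
by apply/polyP => i; rewrite !coef_map; exact: mcoeff0K.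
Qed.

(** Base of the tower: one variable directly over R, bypassing [{mpoly R[0]}], which is only
    isomorphic to R. *)
Lemma mpoly1_ext : poly_ext (mpolyC_rmorphism 1) ('X_ord_max : {mpoly R[1]}).
Proof.
apply: (PolyExt of_poly_mpoly1K to_poly_mpoly1K) => [a|].
  rewrite /= map_polyC -[LHS]/(of_poly_mpoly 0 a%:MP%:P) of_poly_mpolyE.
  by rewrite map_polyC hornerC /= mwidenC.
by rewrite /= map_polyX -[LHS]/(of_poly_mpoly 0 'X) of_poly_mpolyE map_polyX hornerX.
Qed.

Lemma const_coef_mcoeff0 n (p : {mpoly R[n.+1]}) :
  (const_coef (mpoly_ext n) p)@_0 = p@_0.
Proof.
set c := const_coef _ p.
have [t tE] : exists t, p - mwiden c = 'X_ord_max * t.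
  apply: (const_coef_eq0 (ext := mpoly_ext n)).
  by rewrite rmorphB [const_coef _ (mwiden c)](const_coefC (mpoly_ext n)) subrr.
rewrite -[p](subrK (mwiden c)) tE -[RHS]/(mcoeff0_rmorphism _ _) rmorphD rmorphM /=.
rewrite mcoeffX mnm1_eq0 mul0r add0r.
by rewrite -(mwiden_mnmwiden c) mnmwiden0.
Qed.

End MpolyExtension.

Lemma mpoly_resolutions (K : fieldType) n : resolutions_of_length {mpoly K[n]} n.
Proof.
elim: n => [|n IHn]; last exact: (resolutions_of_length_ext (mpoly_ext K n) IHn).
apply: field_resolutions => a a0; exists ((a@_0)^-1)%:MP.
have ac0 : a@_0 != 0.
  by apply/eqP => ac; apply: a0; rewrite (mpoly0_const a) ac mpolyC0.
by rewrite {2}(mpoly0_const a) -mpolyCM mulVf.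
Qed.

Lemma mpoly_mpoly_resolutions (R : comNzRingType) d n :
  resolutions_of_length R d -> resolutions_of_length {mpoly R[n.+1]} (n.+1 + d).
Proof.
move=> resR; elim: n => [|n IHn].
  exact: (resolutions_of_length_ext (mpoly1_ext R) resR).
exact: (resolutions_of_length_ext (mpoly_ext R n.+1) IHn).
Qed.

(** If all cohomology vanished, it would still vanish after setting the variables to 0 one by one.
    On the constants that remain, G acts as 0, so 1 is a nonzero torsion element in degree 0. The
    constant-term condition survives each step by [const_coef_mcoeff0]. *)
Lemma specialization_nonacyclic (K : fieldType) n (R : comNzRingType) d
    (rho : {rmorphism R -> {mpoly K[n]}}) (G : R -> Prop) :
  resolutions_of_length R d -> (forall a, G a -> (rho a)@_0 = 0) ->
  exists i, cohomology_neq0 G (restr rho {mpoly K[n]}^o) i.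
Proof.
move=> resR; elim: n rho => [|n IHn] rho rhoG.
  have [E _] := resR (restr rho {mpoly K[0]}^o).
  exists 0%N; apply: (cohomology0_torsion E (x := 1)); last exact/eqP/oner_neq0.
  move=> a Ga; exists 1%N; rewrite restrE expr1 (mpoly0_const (rho a)) rhoG //.
  by rewrite mpolyC0 scale0r.
apply: contrapT => /forallNP S0.
have [i] := IHn (specialize (mpoly_ext K n) rho) (fun a Ga =>
  etrans (const_coef_mcoeff0 (rho a)) (rhoG a Ga)).
by have := specialize_acyclic (ext := mpoly_ext K n) resR S0 (i := i); exact.
Qed.

Lemma cohomology_neq0_iso (R : comNzRingType) (G : R -> Prop) (M N : lmodType R)
    (f : {linear M -> N}) i : bijective f ->
  cohomology_neq0 G N i -> cohomology_neq0 G M i.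
Proof.
move=> [f' fK f'K] [E [e [[te de] ne]]].
have aug_lin : linear (res_aug E \o f) by move=> a u v; rewrite /= !linearP.
have aug_inj : injective (mk_linear aug_lin).
  by move=> u v /= /res_aug_inj/(can_inj fK).
have ex0 u : res_d E 0 u = 0 <-> exists x, u = mk_linear aug_lin x.
  split=> [/res_exact0 [y ->]|[x ->]]; last exact: res_d_aug.
  by exists (f' y); rewrite /= f'K.
pose E' := InjectiveResolution (@res_injective _ _ E) aug_inj ex0 (@res_exactS _ _ E).
by exists E', e; split=> // be; apply: ne; case: i e te de be.
Qed.

(** * Adjoining all the variables *)

Section Tower.
Variables (R : comNzRingType) (d : nat) (G : R -> Prop).
Hypothesis resR : resolutions_of_length R d.

Definition mpoly_gens n (p : {mpoly R[n]}) : Prop :=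
  (exists2 a, G a & p = a%:MP) \/ exists i, p = 'X_i.

Lemma mpoly_gens1 p : mpoly_gens p <->
  (exists2 a, G a & p = mpolyC_rmorphism R 1 a) \/ p = 'X_ord_max.
Proof.
split=> [[Gp|[i ->]]|[Gp|->]]; [by left| |by left|by right; exists ord_max].
by right; congr 'X__; apply: val_inj; case: i => [[]].
Qed.

Lemma mpoly_gensS n p : @mpoly_gens n.+1 p <->
  (exists2 q, mpoly_gens q & p = mwiden_rmorphism R n q) \/ p = 'X_ord_max.
Proof.
split.
  case=> [[a Ga ->]|[i ->]].
    by left; exists a%:MP; [left; exists a | rewrite /= mwidenC].
  have [->|ni] := eqVneq i ord_max; [by right | left].
  have i_n : (i < n)%N.
    by rewrite ltn_neqAle -ltnS ltn_ord andbT; move: ni; rewrite -val_eqE.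
  exists 'X_(Ordinal i_n); first by right; exists (Ordinal i_n).
  by rewrite /= mwidenX mnmwiden1; congr 'X__; apply: val_inj.
case=> [[q [[a Ga ->]|[i ->]] ->]|->]; last by right; exists ord_max.
  by left; exists a => //; rewrite /= mwidenC.
by right; exists (widen_ord (leqnSn n) i); rewrite /= mwidenX mnmwiden1.
Qed.

Lemma mpoly_cohomology_neq0 n i : cohomology_neq0 (@mpoly_gens n.+1) {mpoly R[n.+1]}^o i <->
  exists2 j, cohomology_neq0 G R^o j & i = (j + n.+1)%N.
Proof.
elim: n i => [|n IHn] [|i].
- split=> [|[j _]]; last by rewrite addn1.
  by move/(poly_cohomology_eq0 (mpoly1_ext R) mpoly_gens1 resR).
- rewrite (poly_cohomology_neq0S (mpoly1_ext R) mpoly_gens1 resR).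
  split=> [Hi|[j Hj]]; first by exists i; rewrite ?addn1.
  by rewrite addn1 => -[->].
- split=> [|[j _]]; last by rewrite addnS.
  by move/(poly_cohomology_eq0 (mpoly_ext R n.+1) (@mpoly_gensS _)
    (mpoly_mpoly_resolutions resR)).
rewrite (poly_cohomology_neq0S (mpoly_ext R n.+1) (@mpoly_gensS _)
  (mpoly_mpoly_resolutions resR)) IHn.
split=> [[j Hj ->]|[j Hj]]; first by exists j; rewrite ?addnS.
by rewrite [in RHS]addnS => -[->]; exists j.
Qed.

End Tower.

(** * Determinantal ideals *)

Section Minors.
Variables (R : comNzRingType) (q : nat) (X : 'M[R]_(2, q)).

Definition minor2 (c d : 'I_q) : R := X 0 c * X 1 d - X 0 d * X 1 c.

Lemma det_mx2 (B : 'M[R]_2) : \det B = B 0 0 * B 1 1 - B 0 1 * B 1 0.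
Proof.
rewrite (expand_det_row _ 0) !big_ord_recl big_ord0 addr0 /cofactor !det_mx11 !mxE.
have -> : lift 0 (0 : 'I_1) = 1 :> 'I_2 by apply: val_inj.
have -> : lift 1 (0 : 'I_1) = 0 :> 'I_2 by apply: val_inj.
by rewrite /= expr0 expr1 mul1r mulN1r mulrN.
Qed.

(** Reordering the two columns costs a sign and equal columns give 0, so later arguments need not
    order columns. *)
Lemma det_ideal_minor2 c d : det_ideal 2 X (minor2 c d).
Proof.
have mono (a b : 'I_q) : (a < b)%N -> det_ideal 2 X (minor2 a b).
  move=> ab; apply: ideal_gen_sub.
  exists id, (fun i : 'I_2 => if i == 0 then a else b); split=> //.
    by move=> [[|[|]]// ?] [[|[|]]// ?].
  by rewrite det_mx2 !mxE.
have [/mono //|/mono|cd] := ltngtP c d.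
  by move/(idealN (ideal_gen_ideal _)); rewrite opprB.
rewrite (val_inj cd) /minor2 subrr; exact: (ideal_gen_ideal _).1.
Qed.

Lemma det_ideal_min (I : R -> Prop) : is_ideal I ->
  (forall c d, I (minor2 c d)) -> forall x, det_ideal 2 X x -> I x.
Proof.
move=> iI Im; apply: ideal_gen_min => // _ [f [g [f_mono _ ->]]].
have f01 : (f 0%R < f 1%R)%N by apply: f_mono.
have [f0 f1] : f 0 = 0 /\ f 1 = 1.
  by split; apply: val_inj; move: f01; case: (f 0) (f 1) => [[|[|]]// ?] [[|[|]]// ?].
by rewrite det_mx2 !mxE f0 f1; exact: Im.
Qed.

Definition minor2_family (i : 'I_#|{: 'I_q * 'I_q}|) : R :=
  minor2 (enum_val i).1 (enum_val i).2.

Lemma det_ideal_family x : det_ideal 2 X x <-> ideal_of_family minor2_family x.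
Proof.
split.
  apply: det_ideal_min => [|c d]; first exact: ideal_gen_ideal.
  by apply: ideal_gen_sub; exists (enum_rank (c, d)); rewrite /minor2_family enum_rankK.
apply: ideal_gen_min => [|_ [i ->]]; first exact: ideal_gen_ideal.
exact: det_ideal_minor2.
Qed.

End Minors.

Lemma is_ara_exists (R : comNzRingType) (I : R -> Prop) s :
  radically_generated I s -> exists2 r, is_ara I r & (r <= s)%N.
Proof.
move=> Is; pose P r := `[< radically_generated I r >].
have exP : exists r, P r by exists s; apply/asboolP.
case: (ex_minnP exP) => r /asboolP Ir min_r; exists r; last exact/min_r/asboolP.
by split=> // t It; apply: min_r; apply/asboolP.
Qed.

Lemma is_cd_exists (R : comNzRingType) (G : R -> Prop) d : resolutions_of_length R d ->
  (exists i, cohomology_neq0 G R^o i) ->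
  exists2 c, cohomology_neq0 G R^o c & forall i, cohomology_neq0 G R^o i -> (i <= c)%N.
Proof.
move=> resR [i0 Hi0]; pose P i := `[< cohomology_neq0 G R^o i >].
have exP : exists i, P i by exists i0; apply/asboolP.
have bP i : P i -> (i <= d)%N.
  move=> /asboolP; have [E Ed] := resR R^o.
  move=> /(cohomology_neq0_any E) [e [_ ne]]; rewrite leqNgt; apply/negP => di.
  by apply: ne; rewrite (Ed i e di); exact: coboundary0.
case: (ex_maxnP exP bP) => c /asboolP Hc max_c; exists c => // i Hi.
by apply: max_c; apply/asboolP.
Qed.

Lemma is_cdE (R : comNzRingType) (I G : R -> Prop) c :
  (forall (N : lmodType R) (e : N), torsion I e <-> tors G e) ->
  is_cd I c <-> cohomology_neq0 G R^o c /\
    forall i, cohomology_neq0 G R^o i -> (i <= c)%N.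
Proof.
move=> IG; have lcE := local_cohomologyE R^o _ IG.
by split=> -[/lcE Hc max_c]; split=> // i /lcE Hi; apply: max_c.
Qed.

(** * The ideal I_2(M) up to radical *)

Section NilpotentBlock.
Variables (R : comNzRingType) (k n : nat) (X : 'M[R]_(2, k)).
Local Notation S := {mpoly R[n]}.
Local Notation J := (det_ideal 2 X).
Local Notation M := (row_mx (map_mx (@mpolyC n R) X) (nilpotent_block R n)).
Local Notation gens := (@mpoly_gens R J n).

Lemma minor2_lshift c d :
  minor2 M (lshift n.+1 c) (lshift n.+1 d) = (minor2 X c d)%:MP.
Proof. by rewrite /minor2 !row_mxEl !mxE mpolyCB !mpolyCM. Qed.

Lemma nilpotent_block_gens i c : ideal_gen gens (nilpotent_block R n i c).
Proof.
rewrite mxE; case: unlift => [l|]; last exact: (ideal_gen_ideal _).1.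
by apply: ideal_gen_sub; right; exists l.
Qed.

Lemma det_ideal_sub_gens x : det_ideal 2 M x -> ideal_gen gens x.
Proof.
have iI := ideal_gen_ideal gens.
apply: det_ideal_min => // c d.
(* A minor with a column in the block has an entry of the block in both of its terms. *)
have rI i e : ideal_gen gens (M i (rshift k e)).
  by rewrite row_mxEr; exact: nilpotent_block_gens.
case: (splitP c) => [c' cE|c' cE]; last first.
  have -> : c = rshift k c' by apply: val_inj.
  by apply: idealB => //; [rewrite mulrC|]; apply: idealM.
have -> : c = lshift n.+1 c' by apply: val_inj.
case: (splitP d) => [d' dE|d' dE]; last first.
  have -> : d = rshift k d' by apply: val_inj.
  by apply: idealB => //; [|rewrite mulrC]; apply: idealM.
have -> : d = lshift n.+1 d' by apply: val_inj.
rewrite minor2_lshift; apply: ideal_gen_sub; left; exists (minor2 X c' d') => //.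
exact: det_ideal_minor2.
Qed.

(* The minor on the adjacent columns l and l+1 of N is                       *)
(* x_(l+1)^2 - x_(l+2) * x_l, so the variables enter the radical one by one. *)
Lemma var_radical (l : 'I_n) : radical (det_ideal 2 M) 'X_l.
Proof.
have iI := ideal_gen_ideal (fun x => exists (f : 'I_2 -> 'I_2) (g : 'I_2 -> 'I_(k + n.+1)),
  [/\ forall i j : 'I_2, (i < j)%N -> (f i < f j)%N,
      forall i j : 'I_2, (i < j)%N -> (g i < g j)%N & x = \det (mxsub f g M)]).
have iR := radical_ideal iI.
have [p] := ubnP (l : nat); elim: p l => // p IHp l lp.
pose a := widen_ord (leqnSn n) l; pose b := lift ord0 l.
have Na : nilpotent_block R n 0 a = 'X_l.
  rewrite mxE eqxx; have -> : a = lift ord_max l.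
    by apply: val_inj; rewrite /= /bump leqNgt ltn_ord.
  by rewrite liftK.
have Nb : nilpotent_block R n 1 b = 'X_l by rewrite mxE /= liftK.
have Na1 : radical (det_ideal 2 M) (nilpotent_block R n 1 a).
  rewrite mxE /=; case: unliftP => [j aE|_]; last exact: iR.1.
  have lj : l = j.+1 :> nat := congr1 val aE.
  by apply: IHp; rewrite -ltnS -lj.
apply: radical_idem; exists 2%N.
have := det_ideal_minor2 M (rshift k a) (rshift k b).
rewrite /minor2 !row_mxEr Na Nb -expr2 => /radical_sub m_rad.
by rewrite -[_ ^+ 2](subrK (nilpotent_block R n 0 b * nilpotent_block R n 1 a));
  apply: idealD => //; apply: idealM.
Qed.

Lemma gens_radical x : gens x -> radical (det_ideal 2 M) x.
Proof.
case=> [[a Ja ->]|[l ->]]; last exact: var_radical.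
apply: radical_sub; move: a Ja.
apply: (ideal_gen_map (phi := mpolyC_rmorphism R n)); first exact: ideal_gen_ideal.
move=> y [f [g [f_mono g_mono ->]]].
apply: (det_ideal_min (X := X) (I := fun y => det_ideal 2 M y%:MP)).
- split; first by rewrite mpolyC0; exact: (ideal_gen_ideal _).1.
  by move=> u v w Iv Iw; rewrite mpolyCD mpolyCM; exact: (ideal_gen_ideal _).2.
- by move=> c d; rewrite -minor2_lshift; exact: det_ideal_minor2.
- by apply: ideal_gen_sub; exists f, g.
Qed.

Lemma torsion_det_gens (N : lmodType S) (e : N) :
  torsion (det_ideal 2 M) e <-> tors gens e.
Proof.
apply: (torsion_tors _ (b := minor2_family M)).
- exact: ideal_gen_ideal.
- by move=> x; move/det_ideal_family.
- by move=> i; apply/radical_sub/det_ideal_sub_gens/det_ideal_minor2.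
- exact: gens_radical.
Qed.

(** Both ideals have the radical of (J, x_1, ..., x_n), and r elements suffice for J. *)
Lemma nilpotent_radically_generated r :
  radically_generated J r -> radically_generated (det_ideal 2 M) (r + n).
Proof.
move=> [a aE].
pose b (i : 'I_(r + n)) : S := match split i with inl j => (a j)%:MP | inr l => 'X_l end.
have bl j : b (lshift n j) = (a j)%:MP by rewrite /b (unsplitK (inl j)).
have br l : b (rshift r l) = 'X_l by rewrite /b (unsplitK (inr l)).
have iJ : is_ideal J := ideal_gen_ideal _.
exists b => x; split=> [[t xt]|].
  have {xt} : radical (ideal_gen gens) x by exists t; exact: det_ideal_sub_gens.
  apply: radical_gen_sub; first exact: ideal_gen_ideal.
  move=> _ [[y Jy ->]|[l ->]]; last first.
    by apply/radical_sub/ideal_gen_sub; exists (rshift r l).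
  have [u yu] := (aE y).1 (radical_sub Jy); exists u.
  rewrite -[_ ^+ u](rmorphXn (mpolyC_rmorphism R n)); move: (y ^+ u) yu.
  apply: (ideal_gen_map (phi := mpolyC_rmorphism R n)); first exact: ideal_gen_ideal.
  by move=> _ [j ->]; apply: ideal_gen_sub; exists (lshift n j).
apply: radical_gen_sub; first exact: ideal_gen_ideal.
move=> _ [i ->]; rewrite /b; case: splitP => [j _|l _]; last exact: var_radical.
have [u au] : radical J (a j).
  by apply/aE/radical_sub/ideal_gen_sub; exists j.
apply: radical_idem; exists u; rewrite -[_ ^+ u](rmorphXn (mpolyC_rmorphism R n)).
by apply: gens_radical; left; exists (a j ^+ u).
Qed.

End NilpotentBlock.

Theorem proposition2p6 (K : fieldType) (m k n : nat) (hn : (1 <= n)%N)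
    (X : 'M[{mpoly K[m]}]_(2, k))
    (hX : forall (i : 'I_2) (j : 'I_k), X i j \is 1.-homog) :
  let J := det_ideal 2 X in
  let M := row_mx (map_mx (@mpolyC n {mpoly K[m]}) X)
                  (nilpotent_block {mpoly K[m]} n) in
  (exists c : nat, is_cd J c /\ is_cd (det_ideal 2 M) (c + n)%N) /\
  (exists r s : nat,
    [/\ is_ara J r, is_ara (det_ideal 2 M) s & (s <= r + n)%N]).
Proof.
move=> J M; split; last first.
  (* The minors themselves bound ara(J), so the minimum exists. *)
  have [|r araJ _] := @is_ara_exists _ J #|{: 'I_k * 'I_k}|.
    exists (minor2_family X) => x.
    by split=> -[t xt]; exists t; apply/det_ideal_family.
  have [s araM le_s] := is_ara_exists (nilpotent_radically_generated n araJ.1).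
  by exists r, s.
have resK := @mpoly_resolutions K m.
have JG (N : lmodType {mpoly K[m]}) (e : N) : torsion J e <-> tors J e.
  apply: (torsion_tors _ (b := minor2_family X)).
  - exact: ideal_gen_ideal.
  - by move=> x; move/det_ideal_family.
  - by move=> i; apply/radical_sub/ideal_gen_sub/det_ideal_minor2.
  - exact: radical_sub.
(* Linear forms have no constant term, hence neither have the minors: J kills K. *)
have J0 a : J a -> a@_0 = 0.
  apply: (det_ideal_min (I := fun a : {mpoly K[m]} => a@_0 = 0)).
    split; first by rewrite mcoeff0.
    move=> u v w v0 w0; rewrite mcoeffD w0 addr0.
    by rewrite -[_@_0]/(mcoeff0_rmorphism _ m _) rmorphM /= v0 mulr0.
  move=> c d.
  have X0 i j : (X i j)@_0 = 0 by apply: dhomog_nemf_coeff (hX i j) _; rewrite mf0.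
  by rewrite -[_@_0]/(mcoeff0_rmorphism _ m _) rmorphB !rmorphM /= !X0 !mul0r subr0.
have [i Hi] : exists i, cohomology_neq0 J {mpoly K[m]}^o i.
  have [i Hi] := specialization_nonacyclic (rho := idfun) resK J0; exists i.
  have id_lin : linear (id : {mpoly K[m]}^o -> restr idfun {mpoly K[m]}^o) by [].
  by apply: (cohomology_neq0_iso (f := mk_linear id_lin)) Hi; exists id.
have [c Hc max_c] := is_cd_exists resK (ex_intro _ i Hi).
exists c; split; first by apply/(is_cdE _ JG).
(* The tower is indexed by [n.+1], as it starts with one variable. *)
case: n hn @M => [//|n] _ M.
apply/(is_cdE _ (@torsion_det_gens _ _ _ X)).
split; first by apply/(mpoly_cohomology_neq0 _ resK); exists c.
by move=> j /(mpoly_cohomology_neq0 _ resK) [j' /max_c le_c ->]; rewrite leq_add2r.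
Qed.
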